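(* Let $\Omega$ be an open subset of $\mathbb{R}^n$. Let $p\in[1,+\infty[$. Let $w$ be a function from $]0,+\infty[$ to itself. Let $$\inf_{r\in]0,+\infty[}w(r)>0,\qquad\sup_{r\in]0,+\infty[}\frac{w(r)}{w(2r)}<+\infty.$$ Then the following statements hold. (i) If $w$ satisfies $\sup_{r\in[\rho,+\infty[}w(r)<+\infty$ for all $\rho\in]0,+\infty[$, then $$\mathrm{cl}_{\mathcal{M}_p^w(\Omega)}\left(\mathcal{M}_p^{w,0}(\Omega)\cap\tilde{C}^\infty(\overline{\Omega})\cap C^0_{ub}(\overline{\Omega})\right)=\mathrm{cl}_{\mathcal{M}_p^w(\Omega)}\left(\mathcal{M}_p^{w,0}(\Omega)\cap C^\infty(\overline{\Omega})\cap C^0_{ub}(\overline{\Omega})\right)=\mathcal{M}_p^{w,0}(\Omega).$$ (ii) If $m_n(\Omega)<+\infty$ and if $w$ satisfies the conditions $$\sup_{r\in]0,1]}w(r)r^{n/p}<+\infty,\qquad\sup_{r\in[1,+\infty[}w(r)<+\infty,\qquad\lim_{\rho\to 0}\sup_{r\in]0,\rho]}w(r)r^{n/p}=0,\qquad( * )$$ then $C^0_{ub}(\overline{\Omega})\subseteq L^\infty(\Omega)\subseteq\mathcal{M}_p^{w,0}(\Omega)$ and $$\mathrm{cl}_{\mathcal{M}_p^w(\Omega)}\left(\tilde{C}^\infty(\overline{\Omega})\cap C^0_{ub}(\overline{\Omega})\right)=\mathrm{cl}_{\mathcal{M}_p^w(\Omega)}\left(C^\infty(\overline{\Omega})\cap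 C^0_{ub}(\overline{\Omega})\right)=\mathcal{M}_p^{w,0}(\Omega).$$ (iii) If $\Omega$ is bounded and if $w$ satisfies the conditions $( * )$, then $\tilde{C}^\infty(\overline{\Omega})\subseteq C^\infty(\overline{\Omega})\subseteq C^0_{ub}(\overline{\Omega})\subseteq L^\infty(\Omega)\subseteq\mathcal{M}_p^{w,0}(\Omega)$ and $$\mathrm{cl}_{\mathcal{M}_p^w(\Omega)}\tilde{C}^\infty(\overline{\Omega})=\mathrm{cl}_{\mathcal{M}_p^w(\Omega)}C^\infty(\overline{\Omega})=\mathcal{M}_p^{w,0}(\Omega).$$
   Context: Here $n\geq 1$ is an integer, $]a,b[$ denotes an open interval, $m_n$ is Lebesgue measure on $\mathbb{R}^n$, $\mathbb{B}_n(x,r)$ is the open Euclidean ball with center $x$ and radius $r$, and $L^p$ is with respect to Lebesgue measure. Functions are real valued and are identified when equal almost everywhere. $\mathrm{cl}_XA$ is the closure of $A$ in the normed space $X$. $C^0_{ub}(\overline{\Omega})$ is the set of bounded uniformly continuous functions on $\overline{\Omega}$; $C^\infty(\overline{\Omega})$ is the set of $f\in C^\infty(\Omega)$ all of whose partial derivatives (of every order, including $f$ itself) extend continuously to $\overline{\Omega}$; $\tilde{C}^\infty(\overline{\Omega})$ is the set of $f:\overline{\Omega}\to\mathbb{R}$ for which there exist an open $W_f\supseteq\overline{\Omega}$ and $F_f\in C^\infty(W_f)$ with $f=F_f$ on $\overline{\Omega}$. Functions on $\overline{\Omega}$ in these spaces are identified with their restrictions to $\Omega$ when compared with function spaces on $\Omega$.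 For $p\in[1,+\infty]$, $w:]0,+\infty[\to]0,+\infty[$, $\rho\in]0,+\infty]$ and a measurable $f:\Omega\to\mathbb{R}$, set $$|f|_{\rho,w,p,\Omega}\equiv\sup_{(x,r)\in\Omega\times]0,\rho[} w(r)\|f\|_{L^p(\mathbb{B}_n(x,r)\cap\Omega)}\in[0,+\infty].$$ The generalized Morrey space $\mathcal{M}_p^w(\Omega)$ is the set of measurable $f:\Omega\to\mathbb{R}$ with $|f|_{+\infty,w,p,\Omega}<+\infty$, normed by $\|f\|_{\mathcal{M}_p^w(\Omega)}\equiv|f|_{+\infty,w,p,\Omega}$. The vanishing generalized Morrey space is $$\mathcal{M}_p^{w,0}(\Omega)\equiv\{f\in\mathcal{M}_p^w(\Omega):\ \lim_{\rho\to 0}|f|_{\rho,w,p,\Omega}=0\}.$$ *)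

(* Defs.v *)
From HB Require Import structures.
From mathcomp Require Import all_boot all_order all_algebra.
From mathcomp Require Import all_classical all_reals all_analysis.

Set Implicit Arguments.
Unset Strict Implicit.
Unset Printing Implicit Defensive.
Import Order.TTheory GRing.Theory Num.Theory.
Import numFieldNormedType.Exports.

Local Open Scope classical_set_scope.
Local Open Scope ring_scope.

(* The space R^n with n >= 1 is ['rV[R]_n.+1] (so [n] below is the dimension
   minus one).  The library norm on it is the max norm; it induces the usual
   topology and the usual bounded sets.  The Euclidean norm is [enorm]. *)

Section lebesgue_outer.
Variables (R : realType) (n : nat).
Implicit Types (a b : 'rV[R]_n.+1) (A : set 'rV[R]_n.+1).

Definition box a b : set 'rV[R]_n.+1 :=
  [set x | forall i, a 0 i < x 0 i <= b 0 i].

Definition box_volume a b : R := \prod_i Num.max 0 (b 0 i - a 0 i).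

Definition box_cover A : set (nat -> 'rV[R]_n.+1 * 'rV[R]_n.+1) :=
  [set B | A `<=` \bigcup_k box (B k).1 (B k).2].

Definition lebesgue_outer A : \bar R :=
  ereal_inf [set (\sum_(k <oo) (box_volume (B k).1 (B k).2)%:E)%E
            | B in box_cover A].

Lemma box_volume_ge0 a b : 0 <= box_volume a b.
Proof. by apply: prodr_ge0 => i _; rewrite le_max lexx. Qed.

Local Open Scope ereal_scope.

Lemma lebesgue_outer_ge0 A : 0 <= lebesgue_outer A.
Proof.
apply: le_ereal_inf_tmp => _ [B _ <-].
by apply: nneseries_ge0 => k _ _; rewrite lee_fin box_volume_ge0.
Qed.

Lemma le_lebesgue_outer : {homo lebesgue_outer : A B / A `<=` B >-> A <= B}.
Proof.
move=> A B AB; apply/ereal_inf_le_tmp => _ [C BC <-].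
by exists C => //; apply: subset_trans BC.
Qed.

Lemma lebesgue_outer0 : lebesgue_outer set0 = 0.
Proof.
apply/eqP; rewrite eq_le lebesgue_outer_ge0 andbT.
apply: ereal_inf_lbound; exists (fun=> (0%R, 0%R)); first exact: sub0set.
rewrite eseries0// => k _ _; congr EFin.
by rewrite /box_volume big_ord_recl !mxE subrr maxxx mul0r.
Qed.

Lemma lebesgue_outer_sigma_subadditive : sigma_subadditive lebesgue_outer.
Proof.
move=> A; have [[i ioo]|] := pselect (exists i, lebesgue_outer (A i) = +oo).
  rewrite (eseries_pinfty _ _ ioo) ?leey// => m _.
  by rewrite -ltNye (lt_le_trans _ (lebesgue_outer_ge0 _)).
rewrite -forallNE => Aoo.
apply/lee_addgt0Pr => _/posnumP[e].
rewrite (le_trans _ (epsilon_trick _ _ _))//; last first.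
  by move=> m; exact: lebesgue_outer_ge0.
pose vol (c : 'rV[R]_n.+1 * 'rV[R]_n.+1) := (box_volume c.1 c.2)%:E.
have vol_ge0 c : 0 <= vol c by rewrite lee_fin box_volume_ge0.
pose P m B := box_cover (A m) B /\
  \sum_(k <oo) vol (B k) <= lebesgue_outer (A m) + (e%:num / (2 ^ m.+1)%:R)%:E.
have [G PG] : {G : nat -> nat -> 'rV[R]_n.+1 * 'rV[R]_n.+1
                  & forall m, P m (G m)}.
  apply: (@choice _ _ P) => m; rewrite /P /lebesgue_outer.
  set S := (X in ereal_inf X); move infS : (ereal_inf S) => iS.
  case: iS infS => [r Sr|Soo|Soo].
  - have en1 : (0 < e%:num / (2 ^ m.+1)%:R)%R by [].
    have /(lb_ereal_inf_adherent en1) : ereal_inf S \is a fin_num by rewrite Sr.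
    move=> [x [B AB muBx] xS].
    by exists B; split => //; rewrite muBx -Sr; exact/ltW.
  - by have := Aoo m; rewrite /lebesgue_outer Soo.
  - have := lebesgue_outer_ge0 (A m).
    by rewrite /lebesgue_outer -/S Soo.
pose H := uncurry G.
have volG_ge0 x : 0 <= (vol \o H) x by exact: vol_ge0.
apply: (@le_trans _ _ (\esum_(i in setT) (vol \o H) i)).
  apply: ereal_inf_lbound => /=.
  have /card_esym/ppcard_eqP[f] := card_nat2.
  exists (H \o f).
    move=> t [i _ Ait].
    have [j _ Bijt] := (PG i).1 _ Ait.
    by exists (f^-1%FUN (i, j)) => //=; rewrite invK ?inE.
  rewrite -(esum_pred_image (vol \o H) _ xpredT) ?[fun=> _]set_true//.
  by rewrite image_eq.
rewrite (_ : esum _ _ = \sum_(i <oo) \sum_(j <oo ) vol (G i j)); last first.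
  pose J : nat -> set (nat * nat) := fun i => [set (i, j) | j in setT].
  rewrite (_ : setT = \bigcup_k J k); last first.
    by rewrite predeqE => -[a b]; split => // _; exists a => //; exists b.
  rewrite esum_bigcupT /=; last 2 first.
    - apply/trivIsetP => i j _ _ ij.
      rewrite predeqE => -[k m] /=; split => //= -[] [_] _ [<-{k} _].
      by move=> [m' _] [] /esym/eqP; rewrite (negbTE ij).
    - by move=> x; exact: vol_ge0.
  rewrite -(image_id [set: nat]) -fun_true esum_pred_image//; last first.
    by move=> m _; exact: esum_ge0.
  apply: eq_eseriesr => /= j _.
  rewrite -(esum_pred_image (vol \o H) (pair j) predT)//=; last first.
    by move=> ? ? _ _; exact: (@can_inj _ _ _ snd).
  by congr esum; rewrite predeqE => -[a b]; split; move=> [i _ <-]; exists i.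
apply: lee_lim.
- apply: is_cvg_nneseries => m *.
  by apply: nneseries_ge0 => k *; exact: (volG_ge0 (m, k)).
- apply: is_cvg_nneseries => m *.
  by apply: adde_ge0 => //; exact: lebesgue_outer_ge0.
- by near=> m; apply: lee_sum => i _; exact: (PG i).2.
Unshelve. all: by end_near. Qed.

HB.instance Definition _ := isOuterMeasure.Build R 'rV[R]_n.+1 lebesgue_outer
  lebesgue_outer0 lebesgue_outer_ge0 le_lebesgue_outer
  lebesgue_outer_sigma_subadditive.

End lebesgue_outer.
Arguments lebesgue_outer {R n}.

Definition caratheodory_measure (R : realType) (T : pointedType)
    (mu : {outer_measure set T -> \bar R}) :
    {measure set (caratheodory_type mu) -> \bar R} :=
  (mu : set (caratheodory_type mu) -> \bar R).

(* The sigma-algebra of the Caratheodory measurable sets is that of all Lebesgue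
   measurable sets, not only the Borel ones. *)
Definition Rspace (R : realType) (n : nat) :
    measurableType (caratheodory_display (@lebesgue_outer R n)) :=
  caratheodory_type (@lebesgue_outer R n).

Definition lebesgue_rV (R : realType) (n : nat) :
    {measure set (Rspace R n) -> \bar R} :=
  caratheodory_measure (@lebesgue_outer R n).
Arguments lebesgue_rV {R n}.

(* A real function on Omega (or on its closure) is represented by a function on
   the whole of R^n whose values outside of the domain are irrelevant. *)

Section function_spaces.
Variables (R : realType) (n : nat).
Implicit Types (Omega W A : set 'rV[R]_n.+1) (f g F : 'rV[R]_n.+1 -> R).
Implicit Types (w : R -> R) (p rho : \bar R).

Definition lebesgue_measurable_fun Omega f :=
  measurable_fun (Omega : set (Rspace R n)) (f : Rspace R n -> R).

Definition Lp_norm A p f : \bar R :=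
  ('N[lebesgue_rV]_p [EFin \o (f \_ A : Rspace R n -> R)])%E.

Definition enorm (x : 'rV[R]_n.+1) : R := Num.sqrt (\sum_i x 0 i ^+ 2).

Definition eball (x : 'rV[R]_n.+1) (r : R) : set 'rV[R]_n.+1 :=
  [set y | enorm (y - x) < r].

Definition partials (s : seq 'I_n.+1) f : 'rV[R]_n.+1 -> R :=
  foldr (fun i g => 'D_(delta_mx 0 i) g) f s.

(* Only meaningful for W open: the iterated partial derivatives of f at a point
   of W then depend only on the values of f on W. *)
Definition smooth W f := forall s : seq 'I_n.+1,
  (forall x, W x -> {for x, continuous (partials s f)}) /\
  (forall x i, W x -> derivable (partials s f) x (delta_mx 0 i)).

(* The spaces of functions on the closure of Omega are compared with spaces of
   functions on Omega by restriction, and functions on Omega are identified when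
   they are equal almost everywhere: [ae_class Omega X] is the set of all
   representatives of the classes of the restrictions to Omega of the elements
   of X.  Since all sets of functions on Omega below are stable under almost
   everywhere equality on Omega, inclusions, intersections and equalities of
   these sets are those of the sets of classes. *)
Definition ae_class Omega (X : set ('rV[R]_n.+1 -> R)) :
    set ('rV[R]_n.+1 -> R) :=
  [set f | exists2 g, X g &
    (f : Rspace R n -> R) = g %[ae lebesgue_rV in (Omega : set (Rspace R n))]].

Definition C0ub Omega : set ('rV[R]_n.+1 -> R) :=
  ae_class Omega [set f |
    [bounded f x | x in closure Omega] /\
    forall e : R, 0 < e -> exists2 d : R, 0 < d &
      forall x y, closure Omega x -> closure Omega y ->
        enorm (x - y) < d -> `|f x - f y| < e].

Definition Cinfty Omega : set ('rV[R]_n.+1 -> R) :=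
  ae_class Omega [set f | smooth Omega f /\
    forall s : seq 'I_n.+1, exists2 g : 'rV[R]_n.+1 -> R,
      {within closure Omega, continuous g} &
      forall x, Omega x -> g x = partials s f x].

Definition Cinfty_tilde Omega : set ('rV[R]_n.+1 -> R) :=
  ae_class Omega [set f | exists W F,
    [/\ open W, closure Omega `<=` W, smooth W F &
        forall x, closure Omega x -> f x = F x]].

Definition Linfty Omega : set ('rV[R]_n.+1 -> R) :=
  [set f | lebesgue_measurable_fun Omega f /\ (Lp_norm Omega +oo f < +oo)%E].

(* The supremum is taken in [0, +oo], hence the [maxe 0]: it only matters for
   Omega empty. *)
Definition morrey_sup rho w p Omega f : \bar R :=
  maxe 0%E (ereal_sup
    [set ((w xr.2)%:E * Lp_norm (eball xr.1 xr.2 `&` Omega) p f)%E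
    | xr in [set xr : 'rV[R]_n.+1 * R |
        [/\ Omega xr.1, 0 < xr.2 & (xr.2%:E < rho)%E]]]).

Definition morrey_norm w p Omega f : \bar R := morrey_sup +oo%E w p Omega f.

Definition morrey w p Omega : set ('rV[R]_n.+1 -> R) :=
  [set f | lebesgue_measurable_fun Omega f /\ (morrey_norm w p Omega f < +oo)%E].

Definition morrey0 w p Omega : set ('rV[R]_n.+1 -> R) :=
  [set f | morrey w p Omega f /\
    morrey_sup rho%:E w p Omega f @[rho --> 0^'+] --> 0%E].

Definition morrey_closure w p Omega (X : set ('rV[R]_n.+1 -> R)) :
    set ('rV[R]_n.+1 -> R) :=
  [set f | morrey w p Omega f /\
    forall e : R, 0 < e -> exists2 g, X g &
      (morrey_norm w p Omega (f \- g)%R < e%:E)%E].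

End function_spaces.

Definition morrey_weight (R : realType) (n : nat) (p : R) (w : R -> R) :=
  [/\ (ereal_sup [set (w r * r `^ (n.+1%:R / p))%:E
                 | r in [set r : R | 0 < r <= 1]%R] < +oo)%E,
      (ereal_sup [set (w r)%:E | r in [set r : R | 1 <= r]%R] < +oo)%E &
      ereal_sup [set (w r * r `^ (n.+1%:R / p))%:E
                | r in [set r : R | 0 < r <= rho]%R]
        @[rho --> (0:R)^'+] --> 0%E].

(* Main.v *)
(** The approximation error is split according to the radius. At small
    radii, [w r ||h||_{L^p(B(x,r))}] is small for every [h] dominated by the
    vanishing function [f], and, provided [w r * r^(n/p)] tends to 0 with
    [r], uniformly for all [h] with a common sup bound. At large radii [w]
    is bounded, so that smallness in [L^p(Omega)] suffices; and [f] is in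
    [L^p(Omega)] because [w] is bounded below. Hence [f] is approximated by
    simple functions [s] with [|f - s| <= |f|], and each [s] by smooth
    functions that have a common sup bound and converge in [L^p]; the latter
    exist because a set of finite measure is approximated by finite unions
    of boxes, whose indicators are pointwise limits of smooth bumps made of
    [exp(-1/t)]. If [w r * r^(n/p)] does not tend to 0, then a vanishing [f]
    has zero norm: cover a cube by about [r^(-n)] balls of radius [r].
    Conversely vanishing is preserved by Morrey limits by the triangle
    inequality. *)
Require Import Defs.
From mathcomp Require Import all_boot all_order all_algebra.
From mathcomp Require Import all_classical all_reals all_analysis.
From mathcomp Require Import measurable_realfun ess_sup_inf.
From mathcomp Require Import lra ring.
Set Implicit Arguments.
Unset Strict Implicit.
Unset Printing Implicit Defensive.
Import Order.TTheory GRing.Theory Num.Theory.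
Import numFieldNormedType.Exports.
Local Open Scope classical_set_scope.
Local Open Scope ring_scope.

(** All approximants come from one algebra [flat_alg] of functions on the whole of R^n, generated by
    the constants and by the functions P(1/s) exp(-1/s) of an affine expression s in one coordinate.
    The polynomial factor P makes the algebra stable under partial derivatives, so smoothness,
    boundedness and the Lipschitz property follow by induction on its construction, without
    convolution. Since its elements are smooth everywhere, the same approximant serves all the
    function spaces of the statement. The obstacle is the order of the choices. The L^p precision is
    divided by the bound of w beyond the radius that separates small from large balls, so this
    radius has to be fixed before the precision. As the radius depends on the sup bound of the
    approximants, that bound may not depend on the precision. Part (i) does not assume that w r *
    r^(n/p) tends to 0, and without this a bounded function need not be vanishing; hence the case
    distinction on the weight. *)

(** * Lebesgue measure on R^n: measurable sets, boxes and Euclidean balls *)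

Section lebesgue_measure_rV.
Variables (R : realType) (n : nat).
Local Notation T := 'rV[R]_n.+1.
Local Notation mu := (@lebesgue_rV R n).
Implicit Types (a b x : T) (i j : 'I_n.+1) (c : R).

(** Cutting every box of a cover along the hyperplane x_i = c gives covers of the two pieces of X.
    Because boxes are half-open, the cut is again a pair of boxes, and their volumes add up exactly
    to the volume of the original. *)
Lemma halfspace_measurable i c :
  measurable ([set x : T | x 0 i <= c] : set (Rspace R n)).
Proof.
apply: (@le_caratheodory_measurable _ _ (@lebesgue_outer R n)) => X.
apply: le_ereal_inf_tmp => _ [B XB <-].
pose B1 k := ((B k).1, \row_j if j == i then Num.min ((B k).2 0 j) c
                              else (B k).2 0 j).
pose B2 k := (\row_j (if j == i then Num.max ((B k).1 0 j) c
                              else (B k).1 0 j), (B k).2).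
have B1X : box_cover (X `&` [set x | x 0 i <= c]) B1.
  move=> x [/XB[k _ Bkx] /= xc]; exists k => // j /=; rewrite mxE.
  by have := Bkx j; case: eqP => // ->; rewrite le_min xc andbT.
have B2X : box_cover (X `&` ~` [set x | x 0 i <= c]) B2.
  move=> x [/XB[k _ Bkx] /= /negP]; rewrite -ltNge => xc.
  exists k => // j /=; rewrite mxE.
  by have := Bkx j; case: eqP => // ->; rewrite gt_max xc andbT.
have volE k : box_volume (B k).1 (B k).2 =
    box_volume (B1 k).1 (B1 k).2 + box_volume (B2 k).1 (B2 k).2.
  rewrite /box_volume (bigD1 i)//= [X in _ = X + _](bigD1 i)//=.
  rewrite [X in _ = _ + X](bigD1 i)//= !mxE !eqxx.
  rewrite [X in _ = _ * X + _](eq_bigr (fun j => Num.max 0 ((B k).2 0 j - (B k).1 0 j))).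
    rewrite [X in _ = _ + _ * X](eq_bigr (fun j => Num.max 0 ((B k).2 0 j - (B k).1 0 j))).
      rewrite -mulrDl; congr (_ * _).
      rewrite /Num.max /Num.min; do ! case: ifPn; rewrite -?leNgt; lra.
    by move=> j /negbTE ji; rewrite mxE ji.
  by move=> j /negbTE ji; rewrite mxE ji.
have vol0 (C : nat -> T * T) k : (0 <= (box_volume (C k).1 (C k).2)%:E)%E.
  by rewrite lee_fin box_volume_ge0.
under eq_eseriesr do rewrite volE EFinD.
rewrite nneseriesD//; apply: leeD; apply: ereal_inf_lbound;
  by [exists B1|exists B2].
Qed.

Lemma box_measurable a b : measurable (box a b : set (Rspace R n)).
Proof.
rewrite (_ : box a b = \bigcap_(i in [set: 'I_n.+1])
    (~` [set x : T | x 0 i <= a 0 i] `&` [set x | x 0 i <= b 0 i])).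
  apply: fin_bigcap_measurable => // i _; apply: measurableI.
    exact/measurableC/halfspace_measurable.
  exact: halfspace_measurable.
apply/seteqP; split => x /= xab i.
  by move=> _; have /andP[] := xab i; split => //; apply/negP; rewrite -ltNge.
have [/negP] := xab i I.
by rewrite -ltNge => -> ->.
Qed.

Lemma lebesgue_rV_box_le a b : (mu (box a b) <= (box_volume a b)%:E)%E.
Proof.
apply: ereal_inf_lbound.
(* The cover is padded with empty boxes, whose volume is 0 because the dimension is positive. *)
exists (fun k => if k == 0%N then (a, b) else (0, 0)).
  by move=> x abx; exists 0%N.
rewrite (nneseries_split 0%N 1%N)/= ?big_nat1 ?add0n; last first.
  by move=> k _; rewrite lee_fin box_volume_ge0.
rewrite eseries0 ?adde0// => -[|k]// _ _ /=.
by rewrite /box_volume big_ord_recl !mxE subrr maxxx mul0r.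
Qed.

Lemma boxE (x : T) (e : R) y :
  box (x - const_mx e) (x + const_mx e) y <->
  forall i, x 0 i - e < y 0 i <= x 0 i + e.
Proof. by split => H i; have := H i; rewrite !mxE. Qed.

(* Every point of an open set lies in a box with rational centre and half-side
   1/(k+1) that is contained in the set; there are countably many such boxes. *)
Lemma open_measurable_rV (U : set T) : open U ->
  measurable (U : set (Rspace R n)).
Proof.
move=> oU.
pose C (qk : 'rV[rat]_n.+1 * nat) : set T :=
  box (map_mx ratr qk.1 - const_mx qk.2.+1%:R^-1)
      (map_mx ratr qk.1 + const_mx qk.2.+1%:R^-1).
rewrite (_ : U = \bigcup_(qk in [set: 'rV[rat]_n.+1 * nat])
    (if `[< C qk `<=` U >] then C qk else set0)).
  apply: countable_bigcupT_measurable => [|qk]; first exact: countableP.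
  by case: ifP => // _; exact: box_measurable.
apply/seteqP; split => [x Ux|x [qk _]]; last by case: asboolP => // + /= => /[apply].
have /nbhs_ballP[e /= e0 xeU] := oU _ Ux.
have [k ke] : exists k : nat, 4 * k.+1%:R^-1 < e.
  have [k _ /(_ k (leqnn k))] := near_infty_natSinv_lt (PosNum (divr_gt0 e0 (ltr0n R 4))).
  by rewrite /= ltr_pdivlMr// mulrC => ?; exists k.
have k0 : 0 < k.+1%:R^-1 :> R by rewrite invr_gt0.
have q_ (i : 'I_n.+1) : {q : rat | `|x 0 i - ratr q| < k.+1%:R^-1}.
  apply: cid; have [|q] := @rat_in_itvoo R (x 0 i - k.+1%:R^-1) (x 0 i + k.+1%:R^-1).
    by rewrite ltrD2l gtrN.
  by rewrite in_itv/= => q_; exists q; rewrite ltr_distlC.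
pose q := \row_i sval (q_ i).
have qx i : `|x 0 i - map_mx ratr q 0 i| < k.+1%:R^-1.
  by rewrite !mxE; exact: (svalP (q_ i)).
exists (q, k) => //=.
rewrite asboolT.
  apply/boxE => i; have := qx i; rewrite ltr_distl => /andP[? ?].
  by apply/andP; split=> //; exact: ltW.
move=> y /boxE /= qy; apply: xeU; split => // i j; rewrite (ord1 i) /ball/=.
move: (qy j) (qx j) k0 ke; rewrite !ltr_distlC; move: (k.+1%:R^-1) => d.
by move=> /andP[? ?] /andP[? ?] ? ?; apply/andP; split; lra.
Qed.

Lemma nbhs_measurable_fun (U : set T) (f : T -> R) : open U ->
  {in U, continuous f} ->
  measurable_fun (U : set (Rspace R n)) (f : Rspace R n -> R).
Proof.
move=> oU cf mU; apply: (measurability _ (RGenOInfty.measurableE R)) => //.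
move=> _ [_ [c ->] <-].
apply: open_measurable_rV; rewrite openE => x [/= Ux]; rewrite in_itv/= andbT => cfx.
apply: filterI; first exact: open_nbhs_nbhs.
have /(_ (`]c, +oo[%classic)) := cf x (mem_set Ux); apply.
by apply: open_nbhs_nbhs; split; [exact: interval_open|rewrite /= in_itv/= cfx].
Qed.

Lemma enorm_ge0 x : 0 <= enorm x. Proof. exact: sqrtr_ge0. Qed.

Lemma coord_le_enorm x i : `|x 0 i| <= enorm x.
Proof.
rewrite -sqrtr_sqr ler_wsqrtr// (bigD1 i)//= lerDl.
by apply: sumr_ge0 => j _; exact: sqr_ge0.
Qed.

(** The crude factor [n.+1] in place of its square root is enough, since only some comparison
    between the max norm and the Euclidean norm is needed. *)
Lemma enorm_le x c : 0 <= c -> (forall i, `|x 0 i| <= c) ->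
  enorm x <= n.+1%:R * c.
Proof.
move=> c0 xc; rewrite -[leRHS]ger0_norm ?mulr_ge0// -sqrtr_sqr ler_wsqrtr//.
apply: (@le_trans _ _ (\sum_(i < n.+1) c ^+ 2)).
  apply: ler_sum => i _; rewrite -[leLHS]real_normK ?num_real//.
  by rewrite ler_sqr ?nnegrE.
rewrite sumr_const card_ord -[leLHS]mulr_natl exprMn ler_wpM2r ?sqr_ge0//.
by rewrite ler_eXnr// ler1n.
Qed.

Lemma eball_sub_box x (r : R) :
  eball x r `<=` box (x - const_mx r) (x + const_mx r).
Proof.
move=> y /= xy; apply/boxE => i.
have := le_lt_trans (coord_le_enorm (y - x) i) xy.
rewrite !mxE ltr_distl => /andP[? ?]; by apply/andP; split; lra.
Qed.

Lemma eball_measurable x (r : R) : measurable (eball x r : set (Rspace R n)).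
Proof.
have mcoord i : measurable_fun setT (fun y : Rspace R n => y 0 i : R).
  apply: (@nbhs_measurable_fun setT _ openT) => y _; exact: coord_continuous.
have menorm : measurable_fun setT (fun y : Rspace R n => enorm (y - x)).
  apply: measurableT_comp; first exact: (continuous_measurable_fun (@sqrt_continuous R)).
  apply: measurable_sum => i; apply: measurable_funX.
  under eq_fun do rewrite !mxE.
  exact: measurable_funB.
rewrite (_ : eball x r = setT `&` (fun y => enorm (y - x)) @^-1` `]-oo, r[%classic).
  exact: (menorm measurableT).
by rewrite setTI; apply/seteqP; split => y /=; rewrite in_itv.
Qed.

Lemma lebesgue_rV_eball_le x (r : R) : 0 < r ->
  (mu (eball x r) <= ((2 * r) ^+ n.+1)%:E)%E.
Proof.
move=> r0; apply: (le_trans (le_lebesgue_outer (@eball_sub_box x r))).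
apply: (le_trans (lebesgue_rV_box_le _ _)).
rewrite lee_fin /box_volume (eq_bigr (fun=> 2 * r)) ?prodr_const ?card_ord//.
move=> i _; rewrite !mxE max_r; lra.
Qed.

End lebesgue_measure_rV.

(** * L^p norms: monotonicity, triangle inequality, convergence theorems *)

Section Lnorm_lemmas.
Context d (T : measurableType d) (R : realType).
Variables (mu : {measure set T -> \bar R}) (p : R).
Hypothesis p1 : 1 <= p.
Implicit Types f g : T -> R.
Local Notation N f := ('N[mu]_p%:E[EFin \o f])%E.

Let p0 : 0 < p. Proof. exact: lt_le_trans p1. Qed.

Lemma lee_poweR (x y : \bar R) (r : R) : 0 <= r -> (0 <= x)%E -> (x <= y)%E ->
  (x `^ r <= y `^ r)%E.
Proof.
move=> r0 x0 xy; apply: gt0_ler_poweR => //; rewrite in_itv/= leey andbT//.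
exact: le_trans xy.
Qed.

Lemma LnormE f : N f = ((\int[mu]_x (`|f x| `^ p)%:E) `^ p^-1)%E.
Proof. by rewrite unlock. Qed.

Lemma measurable_norm_powR f : measurable_fun setT f ->
  measurable_fun setT (fun x => (`|f x| `^ p)%:E).
Proof.
move=> mf; apply/measurable_EFinP.
apply: (measurableT_comp (measurable_powR p)).
exact: measurableT_comp.
Qed.

Lemma le_Lnorm f g : measurable_fun setT f -> measurable_fun setT g ->
  (forall x, `|f x| <= `|g x|) -> (N f <= N g)%E.
Proof.
move=> mf mg fg; rewrite !LnormE; apply: lee_poweR.
- by rewrite invr_ge0 ltW.
- by apply: integral_ge0 => x _; rewrite lee_fin powR_ge0.
apply: ge0_le_integral => //; [exact: measurable_norm_powR..|].
by move=> x _; rewrite lee_fin ge0_ler_powR ?nnegrE// ltW.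
Qed.

Lemma LnormB f g : measurable_fun setT f -> measurable_fun setT g ->
  (N (f \- g)%R <= N f + N g)%E.
Proof.
move=> mf mg; have -> : N g = N (\- g)%R.
  by rewrite -Lnorm_abse -[RHS]Lnorm_abse; apply: eq_Lnorm => x /=; rewrite normrN.
by apply: minkowski_EFin => //; exact: measurableT_comp.
Qed.

Lemma Lnorm_triangle f g h : measurable_fun setT f -> measurable_fun setT g ->
  measurable_fun setT h ->
  (N (f \- h)%R <= N (f \- g)%R + N (g \- h)%R)%E.
Proof.
move=> mf mg mh; have -> : (f \- h)%R = ((f \- g) \+ (g \- h))%R.
  by apply/funext => x /=; rewrite addrA subrK.
by apply: minkowski_EFin => //; exact: measurable_funB.
Qed.

Lemma Lnorm_indic (A : set T) (c : R) : measurable A ->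
  N (fun x => c * \1_A x)%R = (`|c|%:E * mu A `^ p^-1)%E.
Proof.
move=> mA; rewrite LnormE (_ : (\int[mu]_x _)%E = ((`|c| `^ p)%:E * mu A)%E).
  rewrite poweRM ?lee_fin ?powR_ge0// poweR_EFin -powRrM divff ?gt_eqF//.
  by rewrite powRr1.
rewrite -[A in RHS]setIT -integral_indic// -ge0_integralZl//; last first.
  exact/measurable_EFinP/measurable_indic.
apply: eq_integral => x _; rewrite -EFinM; congr EFin.
rewrite normrM powRM//; congr (_ * _).
rewrite indicE; case: (_ \in _) => /=; first by rewrite normr1 powR1.
by rewrite normr0 powR0 ?gt_eqF.
Qed.

(** Serves to show that the nonzero level sets of a simple function in L^p have finite measure. *)
Lemma Lnorm_indic_lty (A : set T) (c : R) : measurable A -> c != 0 ->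
  (N (fun x => c * \1_A x)%R < +oo)%E -> (mu A < +oo)%E.
Proof.
move=> mA c0; rewrite Lnorm_indic// => Nfin.
apply: (@lty_poweRy _ _ p^-1); first by rewrite invr_eq0 gt_eqF.
rewrite ltey; apply/eqP => muoo; move: Nfin.
by rewrite muoo gt0_muley ?lte_fin ?normr_gt0// ltxx.
Qed.

Lemma Lnorm_bounded (A : set T) f C : measurable A -> measurable_fun setT f ->
  0 <= C -> (forall x, `|f x| <= C * \1_A x) ->
  (N f <= C%:E * mu A `^ p^-1)%E.
Proof.
move=> mA mf C0 fC; have -> : C%:E = `|C|%:E by rewrite ger0_norm.
rewrite -Lnorm_indic//.
apply: le_Lnorm => //.
  by apply: measurable_funM => //; exact: measurable_indic.
by move=> x; apply: (le_trans (fC x)); rewrite ler_norm.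
Qed.

(** Dominated convergence for the p-th powers, with |G|^p as the integrable majorant. *)
Lemma Lnorm_dominated_cvg (g_ : nat -> T -> R) (G : T -> R) (e : R) :
  (forall k, measurable_fun setT (g_ k)) -> measurable_fun setT G ->
  (forall k x, `|g_ k x| <= `|G x|) -> (forall x, g_ ^~ x @ \oo --> 0) ->
  (N G < +oo)%E -> 0 < e -> exists k, (N (g_ k) <= e%:E)%E.
Proof.
move=> mg mG gG g0 NG e0.
have intG : mu.-integrable setT (fun x => (`|G x| `^ p)%:E).
  apply/integrableP; split; first exact: measurable_norm_powR.
  under eq_integral do rewrite gee0_abs ?lee_fin ?powR_ge0//.
  move: NG; rewrite LnormE; apply: lty_poweRy.
  by rewrite invr_eq0 gt_eqF.
have cv0 x : (`|g_ k x| `^ p)%:E @[k --> \oo] --> (0 : \bar R).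
  apply: cvg_EFin; first by near=> k.
  apply/cvgr0Pnorm_le => _/posnumP[c]; near=> k => /=.
  rewrite ger0_norm ?powR_ge0//.
  have [->|gk0] := eqVneq (`|g_ k x|) 0; first by rewrite powR0 ?gt_eqF.
  (* Once |g_k x| <= 1, its p-th power is at most |g_k x| itself, as p >= 1. *)
  apply: (@le_trans _ _ `|g_ k x|).
    apply: ge1r_powR p1; rewrite lt0r gk0/= normr_ge0/=.
    near: k; exact: (cvgr0_norm_le _ (g0 x) _ ltr01).
  by near: k; exact: (cvgr0_norm_le _ (g0 x)).
have cvI : (\int[mu]_x (`|g_ k x| `^ p)%:E)%E @[k --> \oo] --> (0 : \bar R).
  rewrite -[X in _ --> X](@integral0 _ _ _ mu setT).
  apply: (dominated_cvg measurableT _ _ _ intG) => // k.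
    exact: measurable_norm_powR.
  by move=> x _; rewrite gee0_abs ?lee_fin ?powR_ge0// ge0_ler_powR ?nnegrE// ltW.
have ep0 : (0 < (e `^ p)%:E)%E by rewrite lte_fin powR_gt0.
have [k _ /(_ k (leqnn k))/= /ltW kint] := cvI _ (open_ereal_lt' ep0).
exists k; rewrite LnormE.
have -> : e%:E = ((e `^ p)%:E `^ p^-1)%E.
  by rewrite poweR_EFin -powRrM divff ?gt_eqF// powRr1// ltW.
apply: lee_poweR => //; first by rewrite invr_ge0 ltW.
by apply: integral_ge0 => x _; rewrite lee_fin powR_ge0.
Unshelve. all: by end_near. Qed.

(** Monotone convergence along an exhaustion of the support of f. It turns bounds that are uniform
    over balls or cubes into a bound for the norm on the whole space. *)
Lemma Lnorm_bigcup_le (A : nat -> set T) f (K : \bar R) :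
  nondecreasing_seq A -> (forall k, measurable (A k)) ->
  measurable_fun setT f -> (forall x, f x != 0 -> exists k, A k x) ->
  (0 <= K)%E -> (forall k, N (f \_ (A k)) <= K)%E -> (N f <= K)%E.
Proof.
move=> ndA mA mf fA K0 NK.
have pV0 : 0 <= p^-1 by rewrite invr_ge0 ltW.
suff: (\int[mu]_x (`|f x| `^ p)%:E <= K `^ p)%E.
  move=> IK; rewrite LnormE; apply: (le_trans (lee_poweR pV0 _ IK)).
    by apply: integral_ge0 => x _; rewrite lee_fin powR_ge0.
  by rewrite -poweRrM divff ?gt_eqF// poweRe1.
have -> : (\int[mu]_x (`|f x| `^ p)%:E =
    \int[mu]_(x in \bigcup_k A k) (`|f x| `^ p)%:E)%E.
  rewrite [RHS]integral_mkcond; apply: eq_integral => x _; rewrite patchE.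
  case: ifPn => // /negP xA; have [->|/fA[k Akx]] := eqVneq (f x) 0.
    by rewrite normr0 powR0// gt_eqF.
  by exfalso; apply: xA; rewrite inE; exists k.
have mfA k : measurable_fun (A k) (fun x => (`|f x| `^ p)%:E).
  by apply: measurable_funTS; exact: measurable_norm_powR.
have cvA := @ge0_nondecreasing_set_cvg_integral _ _ _ A _ mu ndA mA mfA
  (fun _ _ _ => powR_ge0 _ _).
rewrite -(cvg_lim _ cvA)//; apply: lime_le; first by apply/cvg_ex; eexists; exact: cvA.
apply: nearW => k; have := lee_poweR (ltW p0) (Lnorm_ge0 _ _ _) (NK k).
rewrite LnormE -poweRrM mulVf ?gt_eqF// poweRe1; last first.
  by apply: integral_ge0 => x _; rewrite lee_fin powR_ge0.
apply: le_trans; rewrite integral_mkcond le_eqVlt; apply/orP; left; apply/eqP.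
apply: eq_integral => x _; rewrite !patchE; case: ifPn => // _.
by rewrite normr0 powR0// gt_eqF.
Qed.

End Lnorm_lemmas.

(** * The one-variable functions P(1/s) exp(-1/s), extended by 0 *)

Section flat_functions.
Variable R : realType.
Implicit Types (P : {poly R}) (s t u : R).

Definition flat P s : R := if 0 < s then P.[s^-1] * expR (- s^-1) else 0.

Lemma flat_ge0P P s : s <= 0 -> flat P s = 0.
Proof. by rewrite /flat leNgt => /negbTE ->. Qed.

(** With y = 1/s, each monomial satisfies y^i exp(-y) <= i!, by comparison with one term of the
    exponential series; this is where the factorials in the constant come from. *)
Lemma flat_bounded P : exists2 C : R, 0 <= C & forall s, `|flat P s| <= C.
Proof.
exists (\sum_(i < size P) `|P`_i| * i`!%:R).
  by apply: sumr_ge0 => i _; rewrite mulr_ge0.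
move=> s; rewrite /flat; case: ifPn => s0; last first.
  by rewrite normr0; apply: sumr_ge0 => i _; rewrite mulr_ge0.
have y0 : 0 < s^-1 by rewrite invr_gt0.
rewrite horner_coef mulr_suml; apply: le_trans (ler_norm_sum _ _ _) _.
apply: ler_sum => i _; rewrite !normrM -mulrA ler_wpM2l//.
rewrite ger0_norm ?exprn_ge0 ?(ltW y0)// ger0_norm ?expR_ge0//.
rewrite expRN ler_pdivrMr ?expR_gt0//.
have ifact_gt0 : 0 < (i`!%:R : R) by rewrite ltr0n fact_gt0.
rewrite mulrC -ler_pdivrMr//; case: (nat_of_ord i) => [|k].
  by rewrite expr0 fact0 divr1 -expR0 ler_expR ltW.
by apply: le_trans (expR_ge1Dxn k (ltW y0)); rewrite lerDr.
Qed.

(** For s > 0 the chain rule gives s^(-2) (P - P')(1/s) exp(-1/s), which again has the form [flat].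
    Only s = 0 needs an argument. *)
Lemma flat_deriv P s : is_derive s 1 (flat P) (flat ('X^2 * (P - P^`())) s).
Proof.
have [s0|s0|->] := ltgtP s 0.
- rewrite (flat_ge0P _ (ltW s0)); apply: (@near_eq_is_derive _ _ _ (cst 0)).
    near=> t; rewrite flat_ge0P//; apply: ltW; near: t; exact: lt_nbhsl.
- apply: (@near_eq_is_derive _ _ _ (fun t => P.[t^-1] * expR (- t^-1))).
    near=> t; rewrite /flat ifT//; near: t; exact: lt_nbhsr.
  have dV : is_derive s 1 (fun t : R => t^-1) (- s ^- 2).
    have := @is_deriveV _ id s 1 1; rewrite /= gt_eqF// => /(_ isT _).
    by rewrite [_%:A]mulr1; apply.
  have dP : is_derive s 1 (fun t : R => P.[t^-1]) (P^`().[s^-1] * - s ^- 2).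
    exact: (@is_derive1_comp _ (horner P)).
  have dE : is_derive s 1 (fun t : R => expR (- t^-1)) (expR (- s^-1) * - - s ^- 2).
    by apply: (@is_derive1_comp _ expR); exact: is_deriveN.
  apply: (is_derive_eq (is_deriveM dP dE)).
  by rewrite /flat s0 hornerM hornerXn hornerD hornerN exprVn /GRing.scale/=; ring.
- rewrite flat_ge0P//; apply/is_derive1_caratheodory.
  (* This is the difference quotient at 0: dividing P(1/z) exp(-1/z) by z is the same as multiplying
     z by [flat ('X^2 * P) z]. It tends to 0 because the second factor is bounded. *)
  exists (fun z => z * flat ('X^2 * P) z); split; last by rewrite mul0r.
    move=> z; rewrite (flat_ge0P _ (lexx 0)) !subr0 /flat; case: ifPn => z0.
      by rewrite hornerM hornerXn exprVn; field; rewrite gt_eqF.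
    by rewrite mulr0 mul0r.
  have [C C0 PC] := flat_bounded ('X^2 * P).
  suff : z * flat ('X^2 * P) z @[z --> (0 : R)] --> 0 * flat ('X^2 * P) 0 by [].
  rewrite mul0r; apply/cvgr0Pnorm_le => e e0; near=> z.
  rewrite normrM; apply: (@le_trans _ _ (`|z| * (C + 1))).
    by rewrite ler_wpM2l// (le_trans (PC z))// lerDl.
  rewrite -ler_pdivlMr ?ltr_wpDl//; near: z.
  apply: cvgr0_norm_le; first exact: cvg_id.
  by rewrite divr_gt0// ltr_wpDl.
Unshelve. all: by end_near. Qed.

(** Mean value theorem: the derivative is a function of the same kind, hence bounded. *)
Lemma flat_lipschitz P : exists2 L : R, 0 <= L &
  forall s t, `|flat P s - flat P t| <= L * `|s - t|.
Proof.
have [C C0 PC] := flat_bounded ('X^2 * (P - P^`())).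
exists C => // s t; wlog ts : s t / t <= s.
  by move=> wl; have [/wl//|/ltW/wl] := leP t s; rewrite distrC (distrC s).
have [|c _ ->] := MVT_segment ts (fun x _ => flat_deriv P x).
  apply/continuous_subspaceT => x; apply/differentiable_continuous/derivable1_diffP.
  by have [] := flat_deriv P x.
by rewrite normrM ler_wpM2r.
Qed.

End flat_functions.

(** * The algebra of smooth functions on R^n generated by the flat functions *)

Section flat_algebra.
Variables (R : realType) (n : nat).
Local Notation T := 'rV[R]_n.+1.
Implicit Types (f g : T -> R) (x y : T).

Inductive flat_alg : (T -> R) -> Prop :=
| flat_alg_cst c : flat_alg (fun=> c)
| flat_alg_gen P a b i : flat_alg (fun x => flat P (a * x 0 i + b))
| flat_alg_add f g : flat_alg f -> flat_alg g -> flat_alg (fun x => f x + g x)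
| flat_alg_mul f g : flat_alg f -> flat_alg g -> flat_alg (fun x => f x * g x).

Lemma flat_alg_bounded f : flat_alg f -> exists2 C : R, 0 <= C & forall x, `|f x| <= C.
Proof.
elim=> {f} [c|P a b i|f g _ [C C0 fC] _ [D D0 gD]|f g _ [C C0 fC] _ [D D0 gD]].
- by exists `|c|.
- by have [C C0 PC] := flat_bounded P; exists C.
- by exists (C + D) => [|x]; [exact: addr_ge0|rewrite (le_trans (ler_normD _ _))// lerD].
- by exists (C * D) => [|x]; [exact: mulr_ge0|rewrite normrM ler_pM].
Qed.

(** The coordinatewise bound d serves both the max norm, for continuity, and the Euclidean norm, for
    uniform continuity. The product case relies on the boundedness of both factors. *)
Lemma flat_alg_lipschitz f : flat_alg f -> exists2 L : R, 0 <= L &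
  forall x y d, (forall i, `|x 0 i - y 0 i| <= d) -> `|f x - f y| <= L * d.
Proof.
elim=> {f} [c|P a b i|f g _ [C C0 fC] _ [D D0 gD]|f g nf [C C0 fC] ng [D D0 gD]].
- by exists 0 => // x y d _; rewrite subrr normr0 mul0r.
- have [L L0 PL] := flat_lipschitz P.
  exists (L * `|a|); first exact: mulr_ge0.
  move=> x y d /(_ i) xyd; apply: (le_trans (PL _ _)).
  by rewrite opprD addrACA subrr addr0 -mulrBr normrM mulrA ler_wpM2l// mulr_ge0.
- exists (C + D); first exact: addr_ge0.
  move=> x y d xyd; rewrite opprD addrACA (le_trans (ler_normD _ _))//.
  by rewrite mulrDl lerD// ?fC ?gD.
- have [A A0 fA] := flat_alg_bounded nf; have [B B0 gB] := flat_alg_bounded ng.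
  exists (A * D + B * C); first by rewrite addr_ge0// mulr_ge0.
  move=> x y d xyd.
  rewrite (_ : _ - _ = f x * (g x - g y) + g y * (f x - f y)); last by ring.
  rewrite (le_trans (ler_normD _ _))// mulrDl !normrM -!mulrA.
  by rewrite lerD// ler_pM// ?fC ?gD.
Qed.

Lemma flat_alg_continuous f : flat_alg f -> continuous f.
Proof.
move=> /flat_alg_lipschitz[L L0 fL] x.
apply/(@cvgrPdist_le _ _ _ _ (nbhs_filter x)) => e e0.
have d0 : 0 < e / (L + 1) by rewrite divr_gt0// ltr_wpDl.
near=> y; apply: (@le_trans _ _ (L * (e / (L + 1)))).
  have [_ xy] : ball x (e / (L + 1)) y by near: y; exact: nbhsx_ballx.
  by apply: fL => i; apply: ltW; exact: (xy 0 i).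
by rewrite mulrCA ger_pMr// ler_pdivrMr ?ltr_wpDl// mul1r lerDl.
Unshelve. all: by end_near. Qed.

(** Along the j-th basis vector the difference quotient is identically 0 if j differs from i, and
    otherwise it is literally a one-variable difference quotient. *)
Lemma is_derive_coord (h : R -> R) (a b : R) (i j : 'I_n.+1) x (df : R) :
  is_derive (a * x 0 i + b) 1 h df ->
  is_derive x (delta_mx 0 j) (fun y : T => h (a * y 0 i + b))
    ((i == j)%:R * (a * df)).
Proof.
move=> dh.
have dg : is_derive (x 0 i) 1 (fun t => h (a * t + b)) (a * df).
  rewrite mulrC; apply: (@is_derive1_comp _ h (fun t => a * t + b)) => //.
  apply: (is_derive_eq (is_deriveD (is_deriveZ a (is_derive_id _ _)) (is_derive_cst _ _ _))).
  by rewrite addr0 [LHS]mulr1.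
have [ij|ij] := eqVneq i j; last first.
  have E : (fun t : R => t^-1 *: (((fun y : T => h (a * y 0 i + b)) \o shift x)
       (t *: delta_mx 0 j) - h (a * x 0 i + b))) = cst 0.
    apply/funext => t /=.
    by rewrite !mxE eqxx/= (negbTE ij) mulr0 add0r subrr scaler0.
  rewrite mul0r; split; rewrite /derivable /derive E; first exact: is_cvg_cst.
  exact: lim_cst.
rewrite mul1r -ij.
have E : (fun t : R => t^-1 *: (((fun y : T => h (a * y 0 i + b)) \o shift x)
     (t *: delta_mx 0 i) - h (a * x 0 i + b))) =
  (fun t : R => t^-1 *: (((fun t => h (a * t + b)) \o shift (x 0 i)) (t *: 1) - h (a * x 0 i + b))).
  by apply/funext => t /=; rewrite !mxE !eqxx.
by case: dg; split; rewrite /derivable /derive E.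
Qed.

Lemma flat_alg_deriv f (j : 'I_n.+1) : flat_alg f -> exists2 g, flat_alg g &
  forall x, is_derive x (delta_mx 0 j) f (g x).
Proof.
elim=> {f} [c|P a b i|f g nf [f' nf' df] ng [g' ng' dg]|f g nf [f' nf' df] ng [g' ng' dg]].
- by exists (fun=> 0); [exact: flat_alg_cst|move=> x; exact: is_derive_cst].
- exists (fun x => ((i == j)%:R * a) * flat ('X^2 * (P - P^`())) (a * x 0 i + b)).
    by apply: flat_alg_mul; [exact: flat_alg_cst|exact: flat_alg_gen].
  by move=> x; rewrite -mulrA; apply: is_derive_coord; exact: flat_deriv.
- exists (fun x => f' x + g' x); first exact: flat_alg_add.
  by move=> x; exact: is_deriveD.
- exists (fun x => f x * g' x + g x * f' x).
    by apply: flat_alg_add; exact: flat_alg_mul.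
  by move=> x; exact: is_deriveM.
Qed.

Lemma flat_alg_partials f (s : seq 'I_n.+1) : flat_alg f -> flat_alg (partials s f).
Proof.
move=> nf; elim: s => [//|j s /(flat_alg_deriv j)[g ng dg]] /=.
by rewrite (_ : (fun _ => _) = g)//; apply/funext => x; apply: derive_val.
Qed.

Lemma flat_alg_smooth (W : set T) f : flat_alg f -> smooth W f.
Proof.
move=> nf s; have ns := flat_alg_partials s nf; split=> [x _|x i _].
  exact: flat_alg_continuous.
by have [g _ /(_ x)[]] := flat_alg_deriv i ns.
Qed.

Lemma flat_alg_prod (I : Type) (r : seq I) (F : I -> T -> R) :
  (forall i, flat_alg (F i)) -> flat_alg (fun x => \prod_(i <- r) F i x).
Proof.
move=> nF; elim: r => [|i r IH].
  by under eq_fun do rewrite big_nil; exact: flat_alg_cst.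
by under eq_fun do rewrite big_cons; exact: flat_alg_mul.
Qed.

End flat_algebra.

(** * From L^1 to L^p for functions bounded by 1 *)

Section Lnorm_indicator.
Context d (T : measurableType d) (R : realType).
Variables (mu : {measure set T -> \bar R}) (p : R).
Hypothesis p1 : 1 <= p.

Let p0 : 0 < p. Proof. exact: lt_le_trans p1. Qed.

(** Since |f| <= 1 implies |f|^p <= |f|, indicators need to be approximated in L^1 only, with
    precision e^p. *)
Lemma Lnorm_le1 (f : T -> R) (e : R) : measurable_fun setT f -> 0 <= e ->
  (forall x, `|f x| <= 1) -> ('N[mu]_1%:E[EFin \o f] <= (e `^ p)%:E)%E ->
  ('N[mu]_p%:E[EFin \o f] <= e%:E)%E.
Proof.
move=> mf e0 f1 Nf; rewrite LnormE.
have -> : e%:E = ((e `^ p)%:E `^ p^-1)%E.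
  by rewrite poweR_EFin -powRrM divff ?gt_eqF// powRr1.
apply: lee_poweR; first by rewrite invr_ge0 ltW.
  by apply: integral_ge0 => x _; rewrite lee_fin powR_ge0.
apply: (le_trans _ Nf); rewrite Lnorm1.
apply: ge0_le_integral => //.
- exact: measurable_norm_powR.
- by do 2 apply: measurableT_comp => //.
- move=> x _; rewrite /= lee_fin.
  have [->|fx0] := eqVneq (`|f x|) 0; first by rewrite powR0 ?gt_eqF.
  by apply: ge1r_powR p1; rewrite lt0r fx0 normr_ge0 f1.
Qed.

End Lnorm_indicator.

(** * Approximation of measurable functions by differences of simple functions *)

Section simple_approximation.
Import HBNNSimple.
Context d (T : measurableType d) (R : realType).

Lemma nnsfun_approx_le (f : T -> R) : measurable_fun setT f ->
  (forall x, 0 <= f x) ->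
  exists s : nat -> {nnsfun T >-> R}, (forall k x, s k x <= f x) /\
    forall x, s ^~ x @ \oo --> f x.
Proof.
move=> mf f0.
have mEf : measurable_fun setT (EFin \o f) by exact/measurable_EFinP.
have Ef0 x : setT x -> (0 <= (EFin \o f) x)%E by move=> _; rewrite lee_fin f0.
exists (nnsfun_approx measurableT mEf); split=> [k x|x].
  by rewrite nnsfun_approxE -lee_fin; exact: le_approx.
have /fine_cvgP[_] : (nnsfun_approx measurableT mEf k x)%:E @[k --> \oo] --> (f x)%:E.
  exact: cvg_nnsfun_approx.
by [].
Qed.

(** The positive and negative parts are approximated from below. At each point one of s and t is 0,
    so s - t lies between 0 and f. The bounds on s and t separately put both in L^p as soon as f
    is. *)
Lemma signed_nnsfun_approx (f : T -> R) : measurable_fun setT f ->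
  exists s t : nat -> {nnsfun T >-> R}, [/\ forall k x, s k x <= `|f x|,
    forall k x, t k x <= `|f x|, forall k x, `|f x - (s k x - t k x)| <= `|f x| &
    forall x, s k x - t k x @[k --> \oo] --> f x].
Proof.
move=> mf.
have [||s [sf scvg]] := @nnsfun_approx_le (fun x => Num.max (f x) 0).
- exact: measurable_maxr.
- by move=> x; rewrite le_max lexx orbT.
have [||t [tf tcvg]] := @nnsfun_approx_le (fun x => Num.max (- f x) 0).
- by apply: measurable_maxr => //; exact: measurableT_comp.
- by move=> x; rewrite le_max lexx orbT.
have s0 k x : 0 <= s k x by exact: fun_ge0.
have t0 k x : 0 <= t k x by exact: fun_ge0.
exists s, t; split.
- move=> k x; apply: (le_trans (sf k x)).
  by rewrite ge_max ler_norm normr_ge0.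
- move=> k x; apply: (le_trans (tf k x)).
  by rewrite ge_max -normrN ler_norm normr_ge0.
- move=> k x; have := sf k x; have := tf k x; have := s0 k x; have := t0 k x.
  case/orP: (le_total 0 (f x)) => f0.
    rewrite max_r ?oppr_le0// max_l// (ger0_norm f0) ler_norml => *.
    apply/andP; split; lra.
  rewrite max_l ?oppr_ge0// max_r// (ler0_norm f0) ler_norml => *.
  by apply/andP; split; lra.
- move=> x; rewrite (_ : f x = Num.max (f x) 0 - Num.max (- f x) 0).
    exact: cvgB.
  case/orP: (le_total 0 (f x)) => f0.
    by rewrite max_l// max_r ?oppr_le0// subr0.
  by rewrite max_r// max_l ?oppr_ge0// sub0r opprK.
Qed.

End simple_approximation.

(** * L^1 approximation of indicators by elements of [flat_alg] *)

Section smooth_density.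
Variables (R : realType) (n : nat).
Local Notation T := 'rV[R]_n.+1.
Local Notation S := (Rspace R n).
Local Notation mu := (@lebesgue_rV R n).
Local Notation N1 f := ('N[mu]_1%:E[EFin \o (f%R : S -> R)])%E.
Implicit Types (f g h u : T -> R) (a b x : T).

Lemma flat_alg_measurable f : flat_alg f -> measurable_fun setT (f : S -> R).
Proof.
by move=> nf; apply: nbhs_measurable_fun openT _ => x _; exact: flat_alg_continuous.
Qed.

Lemma flat1_ge0 (s : R) : 0 <= flat 1 s.
Proof. by rewrite /flat; case: ifP => // _; rewrite hornerC mul1r expR_ge0. Qed.

Lemma flat1_le1 (s : R) : flat 1 s <= 1.
Proof.
rewrite /flat; case: ifP => // s0.
by rewrite hornerC mul1r expR_le1 oppr_le0 invr_ge0 ltW.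
Qed.

(** From exp(-1/s) >= 1 - 1/s. Steep dilations of [flat 1] thus tend to the indicator of a
    half-line. *)
Lemma cvg_flat1 (s_ : nat -> R) (c : R) : 0 < c ->
  (forall k, c * k.+1%:R <= s_ k) -> flat 1 (s_ k) @[k --> \oo] --> (1 : R).
Proof.
move=> c0 cs; apply/cvgrPdist_le => e e0; near=> k.
have sk0 : 0 < s_ k by rewrite (lt_le_trans _ (cs k))// mulr_gt0.
rewrite ger0_norm ?subr_ge0 ?flat1_le1// /flat sk0 hornerC mul1r lerBlDr.
rewrite -lerBlDl; apply: le_trans (expR_ge1Dx _).
rewrite lerB// -[leRHS]invrK lef_pV2 ?posrE ?invr_gt0//.
apply: le_trans (cs k); rewrite -ler_pdivrMl//.
rewrite -invfM -[leRHS]invrK lef_pV2 ?posrE ?invr_gt0 ?mulr_gt0//.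
apply: ltW; near: k.
exact: (near_infty_natSinv_lt (PosNum (mulr_gt0 c0 e0))).
Unshelve. all: by end_near. Qed.

Lemma cvg_prod_seq (I : Type) (r : seq I) (F : I -> nat -> R) (l : I -> R) :
  (forall i, F i k @[k --> \oo] --> l i) ->
  \prod_(i <- r) F i k @[k --> \oo] --> \prod_(i <- r) l i.
Proof.
move=> Fl; elim: r => [|i r IH].
  by under eq_fun do rewrite big_nil; rewrite big_nil; exact: cvg_cst.
by under eq_fun do rewrite big_cons; rewrite big_cons; exact: cvgM.
Qed.

(** The range [0, 1] is imposed on u because both the union step and the passage from L^1 to L^p
    depend on it. *)
Definition smoothly_approximable (E : set T) := forall e : R, 0 < e ->
  exists u, [/\ flat_alg u, forall x, 0 <= u x <= 1 & (N1 (\1_E \- u)%R <= e%:E)%E].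

Lemma box_smoothly_approximable a b : smoothly_approximable (box a b).
Proof.
move=> e e0.
(* Write K for k+1. The first argument is K (x_i - a_i), which excludes x_i = a_i. The second is K^2
   (b_i + 1/K - x_i): at least K when x_i <= b_i, so that the closed end b_i is kept, and at most 0
   beyond b_i + 1/K. *)
pose F (i : 'I_n.+1) (k : nat) x : R := flat 1 (k.+1%:R * x 0 i + - (k.+1%:R * a 0 i)) *
  flat 1 (- k.+1%:R ^+ 2 * x 0 i + (k.+1%:R ^+ 2 * b 0 i + k.+1%:R)).
pose u k x := \prod_(i < n.+1) F i k x.
have F01 i k x : 0 <= F i k x <= 1.
  by rewrite mulr_ge0 ?flat1_ge0//= mulr_ile1 ?flat1_ge0 ?flat1_le1.
have u01 k x : 0 <= u k x <= 1.
  rewrite /u; elim/big_ind: _ => [|v w /andP[v0 v1] /andP[w0 w1]|//].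
    by rewrite ler01 lexx.
  by rewrite mulr_ge0// mulr_ile1.
have nu k : flat_alg (u k).
  by apply: flat_alg_prod => i; apply: flat_alg_mul; exact: flat_alg_gen.
(* As 1/K <= 1, all the bumps live in this enlarged box, whose indicator dominates every error. *)
pose G : T -> R := \1_(box a (b + const_mx 1)).
have u_out k x i : ~ (a 0 i < x 0 i <= b 0 i + k.+1%:R^-1) -> u k x = 0.
  move=> xi; rewrite /u (bigD1 i)//= [X in X * _](_ : _ = 0) ?mul0r// /F.
  have k0 : 0 < k.+1%:R :> R by [].
  have [xa|ax] := leP (x 0 i) (a 0 i).
    by rewrite flat_ge0P ?mul0r// -mulrBr pmulr_rle0// subr_le0.
  rewrite [X in _ * X]flat_ge0P ?mulr0//.
  have {xi}bx : b 0 i + k.+1%:R^-1 < x 0 i by rewrite ltNge; apply/negP => h; apply: xi; rewrite ax.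
  rewrite [leLHS](_ : _ = k.+1%:R ^+ 2 * (b 0 i + k.+1%:R^-1 - x 0 i)); last first.
    by field; rewrite gt_eqF.
  by rewrite pmulr_rle0 ?exprn_gt0// subr_le0 ltW.
have [||||||k Nk] := @Lnorm_dominated_cvg _ S R mu 1 (lexx 1) (fun k => \1_(box a b) \- u k) G e.
- move=> k; apply: measurable_funB; last exact: flat_alg_measurable.
  exact/measurable_indic/box_measurable.
- exact/measurable_indic/box_measurable.
- move=> k x; rewrite /G /= !indicE.
  have [xG|/negP xG] := boolP (x \in box a (b + const_mx 1)).
    rewrite /= normr1; have := u01 k x; case: (_ \in _) => /= /andP[? ?];
      rewrite ler_norml; apply/andP; split; lra.
  have /existsNP[i xi] : ~ forall i, a 0 i < x 0 i <= b 0 i + 1.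
    by move=> h; apply: xG; rewrite inE => i; have := h i; rewrite !mxE.
  rewrite (u_out k x i); last first.
    move=> /andP[ax xb]; apply: xi; rewrite ax (le_trans xb)// lerD2l.
    by rewrite invf_le1// ler1n.
  rewrite memNset ?subr0//= => /(_ i) /andP[ax xb].
  by apply: xi; rewrite ax (le_trans xb)// lerDl.
- move=> x; rewrite /= indicE; have [xB|xB] := boolP (x \in box a b).
    rewrite (_ : 0 = 1 - \prod_(i < n.+1) (1 * 1) :> R); last first.
      by rewrite big1 ?subrr// => i _; rewrite mulr1.
    apply: cvgB; first exact: cvg_cst.
    apply: cvg_prod_seq => i; move: xB; rewrite inE => /(_ i) /andP[ax xb].
    apply: cvgM.
      apply: (@cvg_flat1 _ (x 0 i - a 0 i)); first by rewrite subr_gt0.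
      by move=> k; rewrite -mulrBr mulrC.
    apply: (@cvg_flat1 _ 1) => // k; rewrite mul1r addrA mulNr addrC lerDl.
    by rewrite addrC -mulrBr mulr_ge0 ?sqr_ge0// subr_ge0.
  have /existsNP[i xi] : ~ forall i, a 0 i < x 0 i <= b 0 i.
    by move=> h; move/negP : xB; apply; rewrite inE.
  (* Off the box the bumps are eventually exactly 0: for every k if x_i <= a_i, and from the moment
     1/K is below x_i - b_i otherwise. *)
  apply: cvg_near_cst; have [bx|xb] := ltP (b 0 i) (x 0 i); last first.
    near=> k; rewrite (u_out k x i) ?subr0// => /andP[ax _].
    by apply: xi; rewrite ax.
  near=> k; rewrite (u_out k x i) ?subr0// => /andP[_].
  apply/negP; rewrite -ltNge -ltrBrDl; near: k.
  have bx0 : 0 < x 0 i - b 0 i by rewrite subr_gt0.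
  exact: (near_infty_natSinv_lt (PosNum bx0)).
- rewrite (_ : G = fun x => 1 * \1_(box a (b + const_mx 1)) x); last first.
    by apply/funext => x; rewrite mul1r.
  rewrite (Lnorm_indic mu (lexx 1))//; last exact: box_measurable.
  rewrite normr1 mul1e; apply: poweR_lty.
  exact: le_lt_trans (lebesgue_rV_box_le _ _) (ltry _).
- exact: e0.
by exists (u k).
Unshelve. all: by end_near. Qed.

Lemma smoothly_approximable0 : smoothly_approximable (set0 : set T).
Proof.
move=> e e0; exists (fun=> 0); split => [|x|]; first exact: flat_alg_cst.
  by rewrite lexx ler01.
rewrite (_ : \1_set0 \- _ = fun x : S => 0 * \1_(setT) x); last first.
  by apply/funext => x; rewrite /= indic0 subr0 mul0r.
rewrite (Lnorm_indic mu (lexx 1))// normr0 mul0e lee_fin; exact: ltW.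
Qed.

(** The approximant u + v - u v imitates the formula for the indicator of a union, and keeps its
    values in [0, 1]. *)
Lemma smoothly_approximableU (E F : set T) :
  measurable (E : set S) -> measurable (F : set S) ->
  smoothly_approximable E -> smoothly_approximable F ->
  smoothly_approximable (E `|` F).
Proof.
move=> mE mF aE aF e e0; have e20 : 0 < e / 2 by rewrite divr_gt0.
have [u [nu u01 Eu]] := aE _ e20; have [v [nv v01 Fv]] := aF _ e20.
exists (fun x => u x + v x + (- 1) * (u x * v x)); split.
- apply: flat_alg_add; first exact: flat_alg_add.
  by apply: flat_alg_mul; [exact: flat_alg_cst|exact: flat_alg_mul].
- move=> x; have := u01 x; have := v01 x; nra.
have mu_ := flat_alg_measurable nu; have mv := flat_alg_measurable nv.
have mEu : measurable_fun setT (fun x : S => `|\1_E x - u x|).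
  apply: (measurableT_comp (@normr_measurable R setT)).
  by apply: measurable_funB; [exact: measurable_indic|exact: mu_].
have mFv : measurable_fun setT (fun x : S => `|\1_F x - v x|).
  apply: (measurableT_comp (@normr_measurable R setT)).
  by apply: measurable_funB; [exact: measurable_indic|exact: mv].
apply: (@le_trans _ _ (N1 (fun x => `|\1_E x - u x| + `|\1_F x - v x|))).
  apply: (le_Lnorm mu (lexx 1)).
  - apply: measurable_funB; first exact/measurable_indic/measurableU.
    apply: measurable_funD; first exact: measurable_funD.
    by apply: measurable_funM; [exact: measurable_cst|exact: measurable_funM].
  - exact: measurable_funD.
  - move=> x /=; rewrite [leRHS]ger0_norm ?addr_ge0//.
    have -> : \1_(E `|` F) x = \1_E x + \1_F x - \1_E x * \1_F x :> R.
      by rewrite !indicE in_setU; do 2 case: (_ \in _) => /=; ring.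
    (* Each of the two errors is multiplied by a factor in [0, 1], so the errors simply add. *)
    rewrite (_ : _ - _ = (\1_E x - u x) * (1 - \1_F x) + (\1_F x - v x) * (1 - u x)); last by ring.
    apply: (le_trans (ler_normD _ _)); rewrite !normrM lerD//.
      rewrite ler_piMr// indicE; case: (_ \in _) => /=; rewrite ?subrr ?normr0 ?subr0 ?normr1//.
    by rewrite ler_piMr// ger0_norm; have := u01 x; lra.
apply: (le_trans (minkowski_EFin _ mEu mFv (lexx 1))).
rewrite (_ : e = e / 2 + e / 2); last by field.
rewrite EFinD; apply: leeD.
  by move: Eu; rewrite -Lnorm_abse.
by move: Fv; rewrite -Lnorm_abse.
Qed.

(** Take a cover by boxes of total volume below mu E + e/3, with finite unions U k and full union
    U'. The three thirds are: E against E [&] U k, by dominated convergence; E [&] U k against U k,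
    bounded by mu (U' [\] E); and U k against its smooth approximant. *)
Lemma finite_measure_smoothly_approximable (E : set T) :
  measurable (E : set S) -> (mu E < +oo)%E -> smoothly_approximable E.
Proof.
move=> mE Efin e e0; have e30 : 0 < e / 3 by rewrite divr_gt0.
have Efin' : mu E \is a fin_num by rewrite ge0_fin_numE.
have [_ [B EB <-]] := lb_ereal_inf_adherent e30 Efin'.
rewrite -/(mu E) => volB.
pose U k := \bigcup_(i < k) box (B i).1 (B i).2.
have mB i : measurable (box (B i).1 (B i).2 : set S) by exact: box_measurable.
have mU k : measurable (U k : set S) by exact: bigcup_measurable.
pose U' := \bigcup_i box (B i).1 (B i).2.
have mU' : measurable (U' : set S) by exact: bigcup_measurable.
have EU' : E `<=` U' by exact: EB.
have aU k : smoothly_approximable (U k).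
  elim: k => [|k IH]; first by rewrite /U bigcup_mkord big_ord0; exact: smoothly_approximable0.
  rewrite (_ : U k.+1 = U k `|` box (B k).1 (B k).2); last first.
    by rewrite /U !bigcup_mkord big_ord_recr.
  by apply: smoothly_approximableU => //; exact: box_smoothly_approximable.
have U'E : (mu (U' `\` E) <= (e / 3)%:E)%E.
  rewrite -(leeD2rE _ _ Efin') [leRHS]addeC.
  have <- : mu U' = (mu (U' `\` E) + mu E)%E.
    by rewrite [LHS](measureDI mu mU' mE) (setIidr EU').
  by apply: le_trans (ltW volB); apply: ereal_inf_lbound; exists B.
have mind (A : set S) : measurable A -> measurable_fun setT (\1_A : S -> R).
  by move=> mA; exact: measurable_indic.
have [||||||k Nk] := @Lnorm_dominated_cvg _ S R mu 1 (lexx 1)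
  (fun k => (\1_E \- \1_(E `&` U k))%R) \1_E (e / 3).
- by move=> k; apply: measurable_funB; apply: mind => //; exact: measurableI.
- exact: mind.
- move=> k x; rewrite /= !indicE in_setI; case: (x \in E); case: (x \in U k);
    by rewrite /= ?subrr ?subr0 ?normr0.
- move=> x; apply: cvg_near_cst.
  have [xE|xE] := boolP (x \in E); last first.
    by apply: nearW => k; rewrite /= !indicE in_setI (negbTE xE) subrr.
  have [k _ Bkx] := EU' _ (set_mem xE).
  exists k.+1 => // j /= kj; rewrite !indicE in_setI xE/=.
  by rewrite mem_set ?subrr//; exists k.
- rewrite (_ : \1_E = fun x : S => 1 * \1_E x); last by apply/funext => x; rewrite mul1r.
  by rewrite (Lnorm_indic mu (lexx 1))// normr1 mul1e; exact: poweR_lty.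
- exact: e30.
have [u [nu u01 Uu]] := aU k _ e30.
exists u; split => //.
have mu_ := flat_alg_measurable nu.
have N2 : (N1 (\1_(E `&` U k) \- \1_(U k))%R <= (e / 3)%:E)%E.
  apply: le_trans U'E.
  rewrite [leRHS](_ : _ = 1%:E * mu (U' `\` E) `^ 1^-1)%E; last first.
    by rewrite mul1e invr1 poweRe1.
  apply: (Lnorm_bounded mu (lexx 1)); [exact: measurableD| |exact: ler01|].
    by apply: measurable_funB; apply: mind => //; exact: measurableI.
  move=> x; rewrite /= !indicE in_setI mul1r in_setD.
  case: (x \in E) => /=; first by rewrite subrr normr0.
  have [xU|xU] := boolP (x \in U k); last by rewrite /= subrr normr0 ler0n.
  rewrite mem_set /= ?sub0r ?normrN1//.
  by case: (set_mem xU) => i _ Bix; exists i.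
apply: (le_trans (Lnorm_triangle mu (lexx 1) (mind _ mE) (mind _ (measurableI _ _ mE (mU k))) mu_)).
rewrite (_ : e = e / 3 + (e / 3 + e / 3)); last by field.
rewrite EFinD leeD// EFinD.
apply: (le_trans (Lnorm_triangle mu (lexx 1) (mind _ (measurableI _ _ mE (mU k))) (mind _ (mU k)) mu_)).
exact: leeD.
Qed.

End smooth_density.

(** * L^p approximation of simple functions with a uniform sup bound *)

Section Lp_smooth_density.
Import HBNNSimple.
Variables (R : realType) (n : nat) (p : R).
Hypothesis p1 : 1 <= p.
Local Notation T := 'rV[R]_n.+1.
Local Notation S := (Rspace R n).
Local Notation mu := (@lebesgue_rV R n).
Local Notation N f := ('N[mu]_p%:E[EFin \o (f%R : S -> R)])%E.
Implicit Types (f g h u : T -> R) (a b x : T).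

Let p0 : 0 < p. Proof. exact: lt_le_trans p1. Qed.

(* The uniform bound does not depend on the precision: it controls the Morrey
   norm of the error at small radii, while the L^p error controls the large
   ones. *)
Definition Lp_approximable h := exists C : R,
  [/\ 0 <= C, forall x, `|h x| <= C &
   forall e : R, 0 < e -> exists g,
     [/\ flat_alg g, forall x, `|g x| <= C & (N (h \- g) <= e%:E)%E]].

Lemma indic_Lp_approximable (E : set T) : measurable (E : set S) ->
  (mu E < +oo)%E -> Lp_approximable \1_E.
Proof.
move=> mE Efin; exists 1; split => // [x|e e0].
  by rewrite indicE; case: (_ \in _); rewrite /= ?normr1 ?normr0.
have [u [nu u01 Eu]] := finite_measure_smoothly_approximable mE Efin (powR_gt0 p e0).
exists u; split => // [x|]; first by have := u01 x; move=> /andP[u0 ?]; rewrite ger0_norm.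
have mEu : measurable_fun setT (\1_E \- u : S -> R).
  by apply: measurable_funB; [exact: measurable_indic|exact: flat_alg_measurable].
apply: (Lnorm_le1 p1 mEu (ltW e0) _ Eu) => x; have := u01 x.
rewrite /= indicE; case: (x \in E) => /= /andP[? ?];
  by rewrite ler_norml; apply/andP; split; lra.
Qed.

Lemma cst0_Lp_approximable : Lp_approximable (fun=> 0).
Proof.
exists 0; split => // [x|e e0]; first by rewrite normr0.
exists (fun=> 0); split => [|x|]; [exact: flat_alg_cst|by rewrite normr0|].
rewrite (_ : _ \- _ = fun x : S => 0 * \1_(setT) x); last first.
  by apply/funext => x; rewrite /= subr0 mul0r.
rewrite (Lnorm_indic mu p1)// normr0 mul0e lee_fin; exact: ltW.
Qed.

Lemma Lnorm_scale (c : R) f : measurable_fun setT (f : S -> R) ->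
  (N (fun x => c * f x) = `|c|%:E * N f)%E.
Proof.
move=> mf; rewrite !LnormE.
under eq_integral do rewrite normrM powRM// EFinM.
rewrite ge0_integralZl//; last exact: measurable_norm_powR.
rewrite poweRM ?lee_fin ?powR_ge0//; last first.
  by apply: integral_ge0 => x _; rewrite lee_fin powR_ge0.
by rewrite poweR_EFin -powRrM divff ?gt_eqF// powRr1.
Qed.

Lemma lin_Lp_approximable (c : R) h k :
  measurable_fun setT (h : S -> R) -> measurable_fun setT (k : S -> R) ->
  Lp_approximable h -> Lp_approximable k ->
  Lp_approximable (fun x => c * h x + k x).
Proof.
move=> mh mk [C [C0 hC hg]] [D [D0 kD kg]].
exists (`|c| * C + D); split.
- by rewrite addr_ge0// mulr_ge0.
- by move=> x; rewrite (le_trans (ler_normD _ _))// lerD// normrM ler_wpM2l.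
move=> e e0.
have c10 : 0 < `|c| + 1 by rewrite ltr_wpDl.
(* Dividing by |c| + 1 instead of |c| covers c = 0 as well. *)
have e1 : 0 < e / 2 / (`|c| + 1) by rewrite !divr_gt0.
have e2 : 0 < e / 2 by rewrite divr_gt0.
have [u [nu uC hu]] := hg _ e1; have [v [nv vD kv]] := kg _ e2.
exists (fun x => c * u x + v x); split.
- by apply: flat_alg_add => //; apply: flat_alg_mul => //; exact: flat_alg_cst.
- by move=> x; rewrite (le_trans (ler_normD _ _))// lerD// normrM ler_wpM2l.
have mu_ := flat_alg_measurable nu; have mv := flat_alg_measurable nv.
have mhu : measurable_fun setT (h \- u : S -> R) by exact: measurable_funB.
have mkv : measurable_fun setT (k \- v : S -> R) by exact: measurable_funB.
rewrite [X in Lnorm _ _ (_ \o X)](_ : _ = ((fun x => c * (h \- u) x) \+ (k \- v))); last first.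
  by apply/funext => x /=; ring.
have mchu : measurable_fun setT (fun x : S => c * (h \- u) x).
  by apply: measurable_funM mhu; exact: measurable_cst.
apply: (le_trans (minkowski_EFin mu mchu mkv p1)).
rewrite (_ : e = e / 2 + e / 2); last by field.
rewrite EFinD leeD// Lnorm_scale//.
apply: (@le_trans _ _ (`|c|%:E * (e / 2 / (`|c| + 1))%:E)%E); first exact: lee_wpmul2l.
rewrite -EFinM lee_fin mulrA ler_pdivrMr// mulrC ler_wpM2l//; first exact: ltW.
by rewrite lerDl.
Qed.

(** A simple function is the finite sum over its values y of y times the indicator of the level set
    {s = y}. Finiteness of the norm makes the level sets with y != 0 of finite measure; the level
    set of 0 may be infinite, so its term is treated as the zero function. *)
Lemma nnsfun_Lp_approximable (s : {nnsfun S >-> R}) :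
  (N s < +oo)%E -> Lp_approximable s.
Proof.
move=> sfin.
have mpre (y : R) : measurable (s @^-1` [set y] : set S) by [].
have mterm (y : R) :
    measurable_fun setT (fun x : S => y * \1_(s @^-1` [set y]) x).
  by apply: measurable_funM; [exact: measurable_cst|exact: measurable_indic].
have aterm (y : R) : Lp_approximable (fun x => y * \1_(s @^-1` [set y]) x).
  have [->|y0] := eqVneq y 0.
    by under eq_fun do rewrite mul0r; exact: cst0_Lp_approximable.
  have preval x : `|y * \1_(s @^-1` [set y]) x| <= `|s x|.
    rewrite indicE; have [|_] := boolP (x \in _).
      by rewrite inE /= => ->; rewrite mulr1.
    by rewrite mulr0 normr0.
  rewrite (_ : (fun x => _) =
      (fun x => y * \1_(s @^-1` [set y]) x + (fun=> 0) x)); last first.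
    by apply/funext => x; rewrite addr0.
  apply: (@lin_Lp_approximable y (\1_(s @^-1` [set y])) (fun=> 0)).
  - exact: measurable_indic.
  - exact: measurable_cst.
  - apply: (indic_Lp_approximable (mpre y)).
    apply: (Lnorm_indic_lty p1 (mpre y) y0); apply: le_lt_trans sfin.
    by apply: (le_Lnorm mu p1 (mterm y) _ preval); exact: measurable_funP.
  - exact: cst0_Lp_approximable.
have -> : (s : T -> R) = fun x => \sum_(y <- finmap.enum_fset (fset_set (range s))) y * \1_(s @^-1` [set y]) x.
  by apply/funext => x; rewrite fimfunE fsbig_finite//=.
elim: (X in Lp_approximable (fun x => \sum_(y <- X) _)) => [|y r IH].
  by under eq_fun do rewrite big_nil; exact: cst0_Lp_approximable.
under eq_fun do rewrite big_cons -[X in X + _]mul1r.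
apply: (lin_Lp_approximable 1 (mterm y) _ (aterm y) IH).
by apply: measurable_sum => z; exact: mterm.
Qed.

End Lp_smooth_density.

(** * Elementary properties of Morrey norms and of vanishing *)

Section morrey_basics.
Variables (R : realType) (n : nat) (Omega : set 'rV[R]_n.+1) (p : R) (w : R -> R).
Hypothesis Omega_open : open Omega.
Hypothesis p1 : 1 <= p.
Hypothesis w_gt0 : forall r, 0 < r -> 0 < w r.
Local Notation T := 'rV[R]_n.+1.
Local Notation S := (Rspace R n).
Local Notation mu := (@lebesgue_rV R n).
Local Notation N f := ('N[mu]_p%:E[EFin \o (f%R : S -> R)])%E.
Implicit Types (f g h u : T -> R) (a b x : T) (A B : set T).

Let p0 : 0 < p. Proof. exact: lt_le_trans p1. Qed.
Let mOmega : measurable (Omega : set S). Proof. exact: open_measurable_rV. Qed.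

Lemma restrict_measurable A f : measurable (A : set S) ->
  lebesgue_measurable_fun A f -> measurable_fun setT (f \_ A : S -> R).
Proof. by move=> mA mf; exact: (proj1 (@measurable_restrictT _ _ S R A f mA) mf). Qed.

Lemma Lp_normE A f : Lp_norm A p%:E f = N (f \_ A).
Proof. by []. Qed.

Lemma measurable_subset A B f : measurable (A : set S) -> measurable (B : set S) ->
  A `<=` B -> lebesgue_measurable_fun B f -> lebesgue_measurable_fun A f.
Proof. by move=> mA mB AB; rewrite /lebesgue_measurable_fun; exact: measurable_funS. Qed.

Lemma Lp_norm_le_dom A f g : measurable (A : set S) ->
  lebesgue_measurable_fun A f -> lebesgue_measurable_fun A g ->
  (forall x, A x -> `|f x| <= `|g x|) ->
  (Lp_norm A p%:E f <= Lp_norm A p%:E g)%E.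
Proof.
move=> mA mf mg fg; apply: (le_Lnorm mu p1); [exact: restrict_measurable..|].
move=> x; rewrite !patchE; case: ifPn => // xA; apply: fg.
by rewrite inE in xA.
Qed.

Lemma Lp_norm_le_set A B f : measurable (A : set S) -> measurable (B : set S) ->
  A `<=` B -> lebesgue_measurable_fun B f ->
  (Lp_norm A p%:E f <= Lp_norm B p%:E f)%E.
Proof.
move=> mA mB AB mf; apply: (le_Lnorm mu p1); [|exact: restrict_measurable|].
  exact/restrict_measurable/(measurable_subset mA mB AB).
move=> x; rewrite !patchE; case: ifPn => [xA|_]; last by rewrite normr0.
by rewrite mem_set//; apply: AB; rewrite inE in xA.
Qed.

Lemma Lp_norm_bounded A f C : measurable (A : set S) ->
  lebesgue_measurable_fun A f -> 0 <= C -> (forall x, A x -> `|f x| <= C) ->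
  (Lp_norm A p%:E f <= C%:E * mu A `^ p^-1)%E.
Proof.
move=> mA mf C0 fC; apply: (Lnorm_bounded mu p1) => //.
  exact: restrict_measurable.
move=> x; rewrite patchE indicE; case: ifPn => xA /=; last by rewrite normr0 mulr0.
by rewrite mulr1 fC//; rewrite inE in xA.
Qed.

Lemma eballI_measurable x r : measurable (eball x r `&` Omega : set S).
Proof. by apply: measurableI => //; exact: eball_measurable. Qed.

(** The origin of the exponent n/p in the conditions on the weight: a ball of radius r has measure
    at most (2r)^n. *)
Lemma Lp_norm_eball_bounded f C x r : lebesgue_measurable_fun Omega f ->
  0 <= C -> 0 < r -> (forall y, Omega y -> `|f y| <= C) ->
  (Lp_norm (eball x r `&` Omega) p%:E f <=
    (C * 2 `^ (n.+1%:R / p) * r `^ (n.+1%:R / p))%:E)%E.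
Proof.
move=> mf C0 r0 fC.
have mB := eballI_measurable x r.
apply: (le_trans (Lp_norm_bounded mB _ C0 _)).
- by apply: measurable_subset mf => //; exact: subIsetr.
- by move=> y [_ /fC].
rewrite -mulrA EFinM; apply: lee_wpmul2l => //.
apply: (@le_trans _ _ (((2 * r) ^+ n.+1)%:E `^ p^-1)%E).
  apply: lee_poweR => //; first by rewrite invr_ge0 ltW.
  apply: le_trans (lebesgue_rV_eball_le x r0).
  by apply: le_measure; rewrite ?inE//; exact: eball_measurable.
rewrite poweR_EFin lee_fin -powR_mulrn ?mulr_ge0 ?(ltW r0)// -powRrM.
by rewrite powRM ?lexx ?(ltW r0)//.
Qed.

Lemma morrey_sup_ge0 rho f : (0 <= morrey_sup rho w p%:E Omega f)%E.
Proof. by rewrite /morrey_sup le_max lexx. Qed.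

Lemma morrey_sup_le rho f c : (0 <= c)%E ->
  (forall x r, Omega x -> 0 < r -> (r%:E < rho)%E ->
     ((w r)%:E * Lp_norm (eball x r `&` Omega) p%:E f <= c)%E) ->
  (morrey_sup rho w p%:E Omega f <= c)%E.
Proof.
move=> c0 H; rewrite /morrey_sup ge_max c0/=.
by apply: ge_ereal_sup => _ [[x r] [/= Ox r0 rrho] <-]; exact: H.
Qed.

Lemma le_morrey_sup rho f x r : Omega x -> 0 < r -> (r%:E < rho)%E ->
  ((w r)%:E * Lp_norm (eball x r `&` Omega) p%:E f <=
    morrey_sup rho w p%:E Omega f)%E.
Proof.
move=> Ox r0 rrho; rewrite /morrey_sup le_max; apply/orP; right.
by apply: ereal_sup_ubound; exists (x, r).
Qed.

Definition vanishing f := forall e : R, 0 < e -> exists2 d : R, 0 < d &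
  forall x r, Omega x -> 0 < r < d ->
     ((w r)%:E * Lp_norm (eball x r `&` Omega) p%:E f <= e%:E)%E.

Lemma morrey0P f : morrey0 w p%:E Omega f <->
  morrey w p%:E Omega f /\ vanishing f.
Proof.
split=> [[mf cvg0]|[mf vf]]; split => //.
  move=> e e0; have e0' : (0 < e%:E)%E by [].
  have [d /= d0 de] := cvg0 _ (open_ereal_lt' e0').
  exists (d / 2) => [|x r Ox /andP[r0 rd]]; first by rewrite divr_gt0.
  have d20 : 0 < d / 2 by rewrite divr_gt0.
  have := de (d / 2); rewrite /= sub0r normrN gtr0_norm//.
  rewrite ltr_pdivrMr// ltr_pMr// ltr1n => /(_ isT d20) /ltW.
  by apply: le_trans; exact: le_morrey_sup.
apply: cvg_EFin; last first.
  apply/cvgr0Pnorm_le => e e0.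
  have [d d0 vd] := vf _ e0.
  near=> rho.
  have sup_le : (morrey_sup rho%:E w p%:E Omega f <= e%:E)%E.
    apply: morrey_sup_le => [|x r Ox r0]; first by rewrite lee_fin ltW.
    rewrite lte_fin => rrho; apply: vd => //; rewrite r0 (lt_le_trans rrho)//.
    by near: rho; exact: nbhs_right_le.
  rewrite /= ger0_norm ?fine_ge0 ?morrey_sup_ge0//.
  rewrite -lee_fin fineK// ge0_fin_numE ?morrey_sup_ge0//.
  exact: le_lt_trans sup_le (ltry _).
near=> rho; rewrite ge0_fin_numE ?morrey_sup_ge0//.
apply: le_lt_trans mf.2; apply: morrey_sup_le; first exact: morrey_sup_ge0.
by move=> x r Ox r0 _; apply: le_morrey_sup => //; exact: ltry.
Unshelve. all: by end_near. Qed.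

(* Small radii are controlled by the vanishing hypothesis, large radii by the
   global L^p norm. *)
Lemma morrey_norm_le f rho W (c : \bar R) : lebesgue_measurable_fun Omega f ->
  (0 <= c)%E ->
  (forall x r, Omega x -> 0 < r < rho ->
     ((w r)%:E * Lp_norm (eball x r `&` Omega) p%:E f <= c)%E) ->
  (forall r, rho <= r -> w r <= W) -> 0 <= W ->
  (W%:E * Lp_norm Omega p%:E f <= c)%E ->
  (morrey_norm w p%:E Omega f <= c)%E.
Proof.
move=> mf c0 small wW W0 large; apply: morrey_sup_le => // x r Ox r0 _.
have [rrho|rhor] := ltP r rho; first by apply: small => //; rewrite r0.
apply: le_trans large; apply: lee_pmul.
- by rewrite lee_fin ltW// w_gt0.
- exact: Lnorm_ge0.
- by rewrite lee_fin wW.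
- by apply: Lp_norm_le_set mf => //; exact: eballI_measurable.
Qed.

Lemma Lp_normD A f g : measurable (A : set S) ->
  lebesgue_measurable_fun A f -> lebesgue_measurable_fun A g ->
  (Lp_norm A p%:E (f \+ g)%R <= Lp_norm A p%:E f + Lp_norm A p%:E g)%E.
Proof.
move=> mA mf mg.
have -> : Lp_norm A p%:E (f \+ g)%R = N ((f \_ A) \+ (g \_ A)).
  apply: eq_Lnorm => x /=; congr EFin; rewrite !patchE.
  by case: ifP => //= _; rewrite addr0.
by apply: minkowski_EFin => //; exact: restrict_measurable.
Qed.

Lemma morrey_normD f g : lebesgue_measurable_fun Omega f ->
  lebesgue_measurable_fun Omega g ->
  (morrey_norm w p%:E Omega (f \+ g)%R <=
   morrey_norm w p%:E Omega f + morrey_norm w p%:E Omega g)%E.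
Proof.
move=> mf mg; apply: morrey_sup_le => [|x r Ox r0 _].
  by apply: adde_ge0; exact: morrey_sup_ge0.
have mB := eballI_measurable x r.
have msub h : lebesgue_measurable_fun Omega h ->
    lebesgue_measurable_fun (eball x r `&` Omega) h.
  by apply: measurable_subset => //; exact: subIsetr.
have w0 := w_gt0 r0.
apply: (@le_trans _ _ ((w r)%:E * (Lp_norm (eball x r `&` Omega) p%:E f +
    Lp_norm (eball x r `&` Omega) p%:E g))%E).
  by apply: lee_wpmul2l; [rewrite lee_fin ltW|apply: Lp_normD => //; exact: msub].
rewrite ge0_muleDr ?Lnorm_ge0//.
by apply: leeD; apply: le_morrey_sup => //; exact: ltry.
Qed.

Lemma morrey_closure_sub (X : set (T -> R)) :
  X `<=` morrey0 w p%:E Omega ->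
  morrey_closure w p%:E Omega X `<=` morrey0 w p%:E Omega.
Proof.
move=> XM f [mf fX]; apply/morrey0P; split => // e e0.
have e20 : 0 < e / 2 by rewrite divr_gt0.
have [g Xg fg] := fX _ e20.
have /morrey0P[[mg _] /(_ _ e20)[d d0 gd]] := XM _ Xg.
exists d => // x r Ox rd; have /andP[r0 _] := rd.
have mB := eballI_measurable x r.
have msub h : lebesgue_measurable_fun Omega h ->
    lebesgue_measurable_fun (eball x r `&` Omega) h.
  by apply: measurable_subset => //; exact: subIsetr.
have mfg : lebesgue_measurable_fun Omega (f \- g)%R by exact: measurable_funB mf.1 mg.
have w0 := w_gt0 r0.
have -> : f = ((f \- g) \+ g)%R by apply/funext => y /=; rewrite subrK.
apply: (@le_trans _ _ ((w r)%:E * (Lp_norm (eball x r `&` Omega) p%:E (f \- g)%R +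
    Lp_norm (eball x r `&` Omega) p%:E g))%E).
  by apply: lee_wpmul2l; [rewrite lee_fin ltW|apply: Lp_normD => //; exact: msub].
rewrite ge0_muleDr ?Lnorm_ge0// (_ : e = e / 2 + e / 2); last by field.
rewrite EFinD; apply: leeD; last exact: gd.
by apply: le_trans (ltW fg); apply: le_morrey_sup => //; exact: ltry.
Qed.

End morrey_basics.

(** * Density when w r * r^(n/p) tends to 0 *)

Section morrey_density.
Import HBNNSimple.
Variables (R : realType) (n : nat) (Omega : set 'rV[R]_n.+1) (p : R) (w : R -> R).
Hypothesis Omega_open : open Omega.
Hypothesis p1 : 1 <= p.
Hypothesis w_gt0 : forall r, 0 < r -> 0 < w r.
Hypothesis w_ge : exists2 c : R, 0 < c & forall r, 0 < r -> c <= w r.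
Hypothesis w_le : forall rho, 0 < rho -> exists2 W : R, 0 < W &
  forall r, rho <= r -> w r <= W.
Local Notation T := 'rV[R]_n.+1.
Local Notation S := (Rspace R n).
Local Notation mu := (@lebesgue_rV R n).
Local Notation N f := ('N[mu]_p%:E[EFin \o (f%R : S -> R)])%E.
Implicit Types (f g h u : T -> R) (a b x : T) (A B : set T).

Let p0 : 0 < p. Proof. exact: lt_le_trans p1. Qed.
Let mOmega : measurable (Omega : set S). Proof. exact: open_measurable_rV. Qed.

(** Balls of growing radius around one point of Omega exhaust the space. On each of them the L^p
    norm is at most the Morrey norm divided by the lower bound c of w. *)
Lemma morrey_Lp_lty f : morrey w p%:E Omega f -> (Lp_norm Omega p%:E f < +oo)%E.
Proof.
move=> [mf fM]; have [->|/set0P[x0 Ox0]] := eqVneq Omega set0.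
  apply: (@le_lt_trans _ _ (0%:E * mu set0 `^ p^-1)%E); last by rewrite mul0e ltry.
  by apply: Lp_norm_bounded => //; exact: measurable_fun_set0.
have [c c0 wc] := w_ge.
apply: (@le_lt_trans _ _ (c^-1%:E * morrey_norm w p%:E Omega f)%E); last first.
  by rewrite lte_mul_pinfty// ?lee_fin ?invr_ge0 ?(ltW c0).
have mF := restrict_measurable mOmega mf.
rewrite Lp_normE; apply: (@Lnorm_bigcup_le _ S R mu p p1 (fun k => eball x0 k.+1%:R)) => //.
- move=> i j ij; apply/subsetPset => y; rewrite /eball /= => /lt_le_trans; apply.
  by rewrite ler_nat.
- by move=> k; exact: eball_measurable.
- move=> x _; exists (Num.truncn (enorm (x - x0))).
  by rewrite /eball/=; exact: truncnS_gt.
- by apply: mule_ge0; [rewrite lee_fin invr_ge0 ltW|exact: morrey_sup_ge0].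
move=> k; rewrite -patch_setI -Lp_normE lee_pdivlMl//.
apply: (@le_trans _ _ ((w k.+1%:R)%:E * Lp_norm (eball x0 k.+1%:R `&` Omega) p%:E f)%E).
  by apply: lee_wpmul2r; [exact: Lnorm_ge0|rewrite lee_fin wc].
by apply: le_morrey_sup => //; exact: ltry.
Qed.

Definition scaled_weight_vanishes := forall e : R, 0 < e ->
  exists2 d : R, 0 < d & forall r, 0 < r < d -> w r * r `^ (n.+1%:R / p) <= e.

(** The radius d depends on C and e only and not on f, so it can be chosen before the approximant is
    known. *)
Lemma bounded_small_radii C e : scaled_weight_vanishes -> 0 < e ->
  exists2 d : R, 0 < d & forall f, lebesgue_measurable_fun Omega f ->
    (forall x, Omega x -> `|f x| <= C) ->
    forall x r, Omega x -> 0 < r < d ->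
    ((w r)%:E * Lp_norm (eball x r `&` Omega) p%:E f <= e%:E)%E.
Proof.
move=> w0 e0.
pose K := (Num.max 0 C + 1) * 2 `^ (n.+1%:R / p).
have C0 : 0 <= Num.max 0 C + 1 by rewrite addr_ge0// le_max lexx.
have K0 : 0 < K by rewrite mulr_gt0 ?powR_gt0// ltr_wpDl// le_max lexx.
have [d d0 wd] := w0 _ (divr_gt0 e0 K0).
exists d => // f mf fC x r Ox /[dup] rd /andP[r0 _].
have fC' y : Omega y -> `|f y| <= Num.max 0 C + 1.
  by move=> /fC fyC; rewrite (le_trans fyC)// ler_wpDr// le_max lexx orbT.
apply: (@le_trans _ _ ((w r)%:E * (K * r `^ (n.+1%:R / p))%:E)%E).
  apply: lee_wpmul2l; first by rewrite lee_fin ltW// w_gt0.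
  exact: Lp_norm_eball_bounded.
by rewrite -EFinM lee_fin mulrCA mulrC -ler_pdivlMr// wd.
Qed.

Lemma vanishing_Lp_morrey0 f : lebesgue_measurable_fun Omega f ->
  (Lp_norm Omega p%:E f < +oo)%E -> vanishing Omega p w f ->
  morrey0 w p%:E Omega f.
Proof.
move=> mf fLp vf; apply/morrey0P => //; split=> //; split=> //.
have [d d0 fd] := vf _ ltr01; have [W W0 wW] := w_le d0.
apply: (@le_lt_trans _ _ (1 + W%:E * Lp_norm Omega p%:E f)%E); last first.
  by rewrite lte_add_pinfty ?ltry// lte_mul_pinfty// ?lee_fin// ltW.
have WL0 : (0 <= W%:E * Lp_norm Omega p%:E f)%E.
  by apply: mule_ge0; [rewrite lee_fin ltW|exact: Lnorm_ge0].
apply: (morrey_norm_le Omega_open p1 w_gt0 (rho := d) (W := W)) => //.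
- by rewrite adde_ge0.
- by move=> x r Ox rd; rewrite (le_trans (fd _ _ Ox rd))// leeDl.
- exact: ltW.
- by rewrite leeDr.
Qed.

(** The choices are made in this order: d from the vanishing of f, W bounding w beyond d, a simple h
    with L^p error e/4/W; then a sup bound C for h and its approximants, d2 from C, W2 bounding w
    beyond d2, and finally g with L^p error e/4/W2. *)
Lemma flat_alg_morrey_density f e : scaled_weight_vanishes ->
  morrey0 w p%:E Omega f -> 0 < e ->
  exists g, [/\ flat_alg g, morrey0 w p%:E Omega g &
    (morrey_norm w p%:E Omega (f \- g)%R < e%:E)%E].
Proof.
move=> w0 /morrey0P[[mf fM] vf] e0.
have fLp := morrey_Lp_lty (conj mf fM).
have e40 : 0 < e / 4 by rewrite divr_gt0.
pose F : S -> R := f \_ Omega.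
have mF : measurable_fun setT F := restrict_measurable mOmega mf.
have [s [t [sF tF dF cvgF]]] := signed_nnsfun_approx mF.
have [d d0 fd] := vf _ e40; have [W W0 wW] := w_le d0.
have eW0 : 0 < e / 4 / W by rewrite divr_gt0.
have mst k : measurable_fun setT (fun x : S => s k x - t k x) by exact: measurable_funB.
have mFst k : measurable_fun setT (fun x : S => F x - (s k x - t k x)).
  exact: measurable_funB.
have [|k Nk] := @Lnorm_dominated_cvg _ S R mu p p1
  (fun k x => F x - (s k x - t k x)) F (e / 4 / W) mFst mF dF _ fLp eW0.
- move=> x; rewrite (_ : 0 = F x - F x); last by rewrite subrr.
  by apply: cvgB; [exact: cvg_cst|exact: cvgF].
have aS (v : {nnsfun S >-> R}) : (forall x, v x <= `|F x|) -> Lp_approximable p v.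
  move=> vF; apply: nnsfun_Lp_approximable => //; apply: le_lt_trans fLp.
  apply: (le_Lnorm mu p1) => // x; rewrite ger0_norm//; exact: vF.
have [C [C0 hC happ]] : Lp_approximable p (fun x => s k x - t k x).
  rewrite (_ : (fun x => _) = (fun x => (-1) * t k x + s k x)); last first.
    by apply/funext => x; rewrite mulN1r addrC.
  by apply: lin_Lp_approximable => //; exact: aS.
pose h : T -> R := fun x => s k x - t k x.
have mh : lebesgue_measurable_fun Omega h := measurable_funTS (mst k).
have mD1 : lebesgue_measurable_fun Omega (f \- h) by exact: measurable_funB mf mh.
have mB x r := eballI_measurable Omega_open x r.
have msub u x r : lebesgue_measurable_fun Omega u ->
    lebesgue_measurable_fun (eball x r `&` Omega) u.
  by apply: measurable_subset => //; exact: subIsetr.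
have D1 : (morrey_norm w p%:E Omega (f \- h)%R <= (e / 4)%:E)%E.
  apply: (morrey_norm_le Omega_open p1 w_gt0 (rho := d) (W := W)) => //.
  - by rewrite lee_fin ltW.
  - move=> x r Ox /[dup] rd /andP[r0 _]; apply: (le_trans _ (fd _ _ Ox rd)).
    apply: lee_wpmul2l; first by rewrite lee_fin ltW// w_gt0.
    apply: Lp_norm_le_dom => //; [exact: msub..|].
    by move=> y [_ Oy] /=; have := dF k y; rewrite /F patchE mem_set.
  - exact: ltW.
  apply: (@le_trans _ _ (W%:E * (e / 4 / W)%:E)%E); last first.
    by rewrite -EFinM lee_fin mulrC divfK// gt_eqF.
  apply: lee_wpmul2l; first by rewrite lee_fin ltW.
  apply: le_trans Nk; apply: (le_Lnorm mu p1) => //.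
    exact: restrict_measurable.
  move=> x; rewrite /F !patchE; case: ifPn => xO; first by rewrite /= lexx.
  by rewrite normr0.
(* Both h and any approximant g are bounded by C, hence their difference by C + C. *)
have [d2 d20 small] := bounded_small_radii (C + C) w0 e40.
have [W2 W20 wW2] := w_le d20.
have eW20 : 0 < e / 4 / W2 by rewrite divr_gt0.
have [g [ng gC hg]] := happ _ eW20.
have mg := flat_alg_measurable ng.
have mgO : lebesgue_measurable_fun Omega g := measurable_funTS mg.
have mhT : measurable_fun setT (h : S -> R) by exact: mst.
have mD2 : lebesgue_measurable_fun Omega (h \- g) by exact: measurable_funB mh mgO.
have D2 : (morrey_norm w p%:E Omega (h \- g)%R <= (e / 4)%:E)%E.
  apply: (morrey_norm_le Omega_open p1 w_gt0 (rho := d2) (W := W2)) => //.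
  - by rewrite lee_fin ltW.
  - apply: small => // x _ /=.
    by rewrite (le_trans (ler_normB _ _))// lerD// ?hC ?gC.
  - exact: ltW.
  apply: (@le_trans _ _ (W2%:E * (e / 4 / W2)%:E)%E); last first.
    by rewrite -EFinM lee_fin mulrC divfK// gt_eqF.
  apply: lee_wpmul2l; first by rewrite lee_fin ltW.
  apply: le_trans hg; apply: (le_Lnorm mu p1).
  - exact: restrict_measurable.
  - exact: measurable_funB mhT mg.
  - by move=> x; rewrite patchE; case: ifPn => // _; rewrite normr0.
exists g; split => //.
  apply: vanishing_Lp_morrey0 => //; last first.
    move=> e' e'0; have [d3 d30 small3] := bounded_small_radii C w0 e'0.
    by exists d3 => //; exact: small3.
  apply: (@le_lt_trans _ _ (N g)).
    apply: (le_Lnorm mu p1) => //; first exact: restrict_measurable.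
    by move=> x; rewrite patchE; case: ifPn => // _; rewrite normr0.
  have -> : g = (h \- (h \- g))%R by apply/funext => x /=; rewrite opprB addrC subrK.
  apply: le_lt_trans (LnormB mu p1 mhT (measurable_funB mhT mg)) _.
  apply: lte_add_pinfty; last exact: le_lt_trans hg (ltry _).
  apply: le_lt_trans (LnormB mu p1 _ _) _ => //.
  apply: lte_add_pinfty; apply: le_lt_trans fLp; apply: (le_Lnorm mu p1) => // x.
    by rewrite ger0_norm; [exact: sF|exact: fun_ge0].
  by rewrite ger0_norm; [exact: tF|exact: fun_ge0].
have -> : (f \- g)%R = ((f \- h) \+ (h \- g))%R.
  by apply/funext => x /=; rewrite addrA subrK.
apply: le_lt_trans (morrey_normD Omega_open p1 w_gt0 mD1 mD2) _.
apply: (@le_lt_trans _ _ ((e / 4)%:E + (e / 4)%:E)%E); first exact: leeD.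
by rewrite -EFinD lte_fin; lra.
Qed.

End morrey_density.

(** * Triviality of the vanishing space when w r * r^(n/p) does not tend to 0 *)

Section degenerate_weight.
Variables (R : realType) (n : nat) (Omega : set 'rV[R]_n.+1) (p : R) (w : R -> R).
Hypothesis Omega_open : open Omega.
Hypothesis p1 : 1 <= p.
Hypothesis w_gt0 : forall r, 0 < r -> 0 < w r.
Local Notation T := 'rV[R]_n.+1.
Local Notation S := (Rspace R n).
Local Notation mu := (@lebesgue_rV R n).
Local Notation N f := ('N[mu]_p%:E[EFin \o (f%R : S -> R)])%E.
Implicit Types (f g h u : T -> R) (a b x : T) (A B : set T).

Let p0 : 0 < p. Proof. exact: lt_le_trans p1. Qed.
Let mOmega : measurable (Omega : set S). Proof. exact: open_measurable_rV. Qed.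

(* The cube [-L, L]^n meets at most (m+1)^n cells of side s = r/(2n), each of
   which lies in a ball of radius r centred in Omega as soon as it meets Omega;
   and ((m+1) s)^n is bounded independently of r. *)
Lemma cube_ball_cover (L r : R) : 0 < L -> 0 < r <= 1 -> Omega !=set0 ->
  exists (m : nat) (y : {ffun 'I_n.+1 -> 'I_m.+1} -> T),
  [/\ forall j, Omega (y j),
      forall x, Omega x -> (forall i, - L <= x 0 i <= L) ->
        exists j, eball (y j) r x &
      (m.+1%:R * r) ^+ n.+1 <= (4 * n.+1%:R * (L + 1)) ^+ n.+1].
Proof.
move=> L0 /andP[r0 r1] [x0 Ox0].
pose s := r / (2 * n.+1%:R).
have n0 : 0 < n.+1%:R :> R by [].
have n20 : 0 < 2 * n.+1%:R :> R by rewrite mulr_gt0.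
have s0 : 0 < s by rewrite divr_gt0.
pose m := Num.truncn (2 * L / s).
pose J x : {ffun 'I_n.+1 -> 'I_m.+1} :=
  [ffun i => inord (Num.truncn ((x 0 i + L) / s))].
(* A cell without points of Omega in the cube receives the arbitrary centre x0, so that all centres
   lie in Omega. *)
have y_ (j : {ffun 'I_n.+1 -> 'I_m.+1}) : exists y, Omega y /\
    ((exists x, [/\ Omega x, forall i, - L <= x 0 i <= L & J x = j]) ->
     (forall i, - L <= y 0 i <= L) /\ J y = j).
  have [[x [Ox xL xj]]|nx] := pselect (exists x, [/\ Omega x, forall i, - L <= x 0 i <= L & J x = j]).
    by exists x.
  by exists x0.
have [y yP] := choice y_.
exists m, y; split.
- by move=> j; have [] := yP j.
- move=> x Ox xL; exists (J x).
  have [_ [|yL yx]] := yP (J x); first by exists x.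
  have xiE (z : T) : (forall i, - L <= z 0 i <= L) -> forall i,
      (J z i)%:R * s <= z 0 i + L < (J z i).+1%:R * s.
    move=> zL i; have /andP[zL1 zL2] := zL i.
    have zs0 : 0 <= (z 0 i + L) / s by rewrite divr_ge0 ?(ltW s0)//; lra.
    have zm : (Num.truncn ((z 0 i + L) / s)%R < m.+1)%N.
      rewrite ltnS; apply: le_truncn.
      by rewrite ler_pM2r ?invr_gt0//; lra.
    rewrite ffunE inordK// -ler_pdivlMr// -ltr_pdivrMr//.
    exact: truncn_itv.
  rewrite /eball/=.
  apply: (@le_lt_trans _ _ (n.+1%:R * s)).
    apply: enorm_le => [|i]; first exact: ltW.
    have /andP[x1 x2] := xiE _ xL i; have /andP[y1 y2] := xiE _ yL i.
    rewrite yx in y1 y2; rewrite !mxE ler_norml.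
    move: x1 x2 y1 y2; rewrite -natr1 mulrDl mul1r; move: (_ * s) => q *.
    by apply/andP; split; lra.
  rewrite (_ : _ * s = r / 2); first by rewrite ltr_pdivrMr// ltr_pMr// ltr1n.
  by rewrite /s; field; rewrite gt_eqF.
apply: lerXn2r; rewrite ?nnegrE ?mulr_ge0 ?(ltW r0) ?addr_ge0 ?(ltW L0)//.
have -> : r = 2 * n.+1%:R * s by rewrite /s mulrCA mulfV ?gt_eqF// mulr1.
have Ls0 : 0 <= 2 * L / s by apply: divr_ge0; [apply: mulr_ge0|]; rewrite ?ler0n ?ltW.
have : m%:R * s <= 2 * L.
  by rewrite -ler_pdivlMr//; have /andP[] := truncn_itv Ls0.
have s1 : s <= 1.
  rewrite ler_pdivrMr// mul1r (le_trans r1)// -natrM ler1n.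
  by rewrite muln_gt0.
move=> ms; rewrite mulrCA [leRHS](_ : _ = 2 * n.+1%:R * (2 * L + 2)); last by ring.
rewrite ler_pM2l// -natr1 mulrDl mul1r; lra.
Qed.

(** There are arbitrarily small r with w r * r^(n/p) > e0. For these, vanishing with precision e0 *
    e gives an L^p norm of at most e * r^(n/p) on each ball. Summing p-th powers over (m+1)^n balls,
    the factor r^n is absorbed by the number of balls, and what remains is e times a constant
    depending on the cube only. *)
Lemma degenerate_Lp_norm0 f : ~ scaled_weight_vanishes n p w ->
  morrey0 w p%:E Omega f -> Lp_norm Omega p%:E f = 0%E.
Proof.
move=> nw0 /morrey0P[[mf _] vf]; have [Oe|/set0P On0] := eqVneq Omega set0.
  apply/eqP; rewrite eq_le Lnorm_ge0 andbT.
  apply: le_trans (Lp_norm_bounded p1 mOmega mf (lexx 0) _) _; last by rewrite mul0e.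
  by rewrite Oe.
have [e0 e00 we0] : exists2 e0 : R, 0 < e0 & forall d, 0 < d ->
    exists r, 0 < r < d /\ e0 < w r * r `^ (n.+1%:R / p).
  apply: contra_notP nw0 => ne e e0; apply: contra_notP ne => nd.
  exists e => // d d0; apply: contra_notP nd => nr; exists d => // r rd.
  by rewrite leNgt; apply/negP => er; apply: nr; exists r.
apply/eqP; rewrite eq_le Lnorm_ge0 andbT.
have mF := restrict_measurable mOmega mf.
pose F : S -> R := f \_ Omega.
pose cube (k : nat) : set T := box (0 - const_mx k.+1%:R) (0 + const_mx k.+1%:R).
rewrite Lp_normE; apply: (@Lnorm_bigcup_le _ S R mu p p1 cube) => //.
- move=> i j ij; apply/subsetPset => x /boxE xi; apply/boxE => l.
  have := xi l; rewrite mxE => /andP[x1 x2].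
  have ij' : i.+1%:R <= j.+1%:R :> R by rewrite ler_nat.
  by apply/andP; split; lra.
- by move=> k; exact: box_measurable.
- move=> x _; exists (Num.truncn (enorm x)); apply/boxE => i; rewrite mxE.
  have := le_lt_trans (coord_le_enorm x i) (truncnS_gt _).
  by rewrite ltr_norml => /andP[? ?]; apply/andP; split; lra.
move=> k.
pose K := ((4 * n.+1%:R * (k.+1%:R + 1)) ^+ n.+1) `^ p^-1 : R.
suff FK (e : R) : 0 < e -> (N (F \_ (cube k)) <= (K * e)%:E)%E.
  apply/lee_addgt0Pr => e e_gt0; rewrite add0e.
  have K0 : 0 <= K by exact: powR_ge0.
  have eK : 0 < e / (K + 1) by rewrite divr_gt0// ltr_wpDl.
  apply: le_trans (FK _ eK) _; rewrite lee_fin mulrCA ger_pMr//.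
  by rewrite ler_pdivrMr ?ltr_wpDl// mul1r lerDl.
move=> e_gt0.
have [d d0 fd] := vf _ (mulr_gt0 e00 e_gt0).
(* The minimum with 1 is there because the covering by balls is stated for r <= 1. *)
have [r [/andP[r0 rd] wr]] := we0 (Num.min d 1) ltac:(by rewrite lt_min d0 ltr01).
have {rd} [rd r1] : r < d /\ r <= 1 by move: rd; rewrite lt_min => /andP[? /ltW].
have r01 : 0 < r <= 1 by rewrite r0.
have [m [y [Oy cov mr]]] := cube_ball_cover (ltr0Sn R k) r01 On0.
have rp0 : 0 < r `^ (n.+1%:R / p) by exact: powR_gt0.
have yint j : (\int[mu]_x (`|(F \_ (eball (y j) r)) x| `^ p)%:E <= (e `^ p * r ^+ n.+1)%:E)%E.
  have Nj : (N (F \_ (eball (y j) r)) <= (e * r `^ (n.+1%:R / p))%:E)%E.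
    have := fd (y j) r (Oy j) _; rewrite r0 rd => /(_ isT).
    rewrite Lp_normE patch_setI muleC -lee_pdivlMr ?w_gt0// => /le_trans; apply.
    rewrite -EFinM lee_fin ler_pdivrMr ?w_gt0// (mulrC e0) -mulrA ler_pM2l//.
    by rewrite mulrC ltW.
  have := lee_poweR (ltW p0) (Lnorm_ge0 _ _ _) Nj.
  rewrite LnormE -poweRrM mulVf ?gt_eqF// poweRe1; last first.
    by apply: integral_ge0 => x _; rewrite lee_fin powR_ge0.
  rewrite poweR_EFin powRM ?(ltW e_gt0) ?powR_ge0// -powRrM divfK ?gt_eqF//.
  by rewrite powR_mulrn// ltW.
have mFy j : measurable_fun setT (F \_ (eball (y j) r) : S -> R).
  exact: restrict_measurable (eball_measurable _ _) (measurable_funTS mF).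
rewrite LnormE.
apply: (@le_trans _ _ (((m.+1%:R * r) ^+ n.+1 * e `^ p)%:E `^ p^-1)%E).
  apply: lee_poweR; first by rewrite invr_ge0 ltW.
    by apply: integral_ge0 => x _; rewrite lee_fin powR_ge0.
  apply: (@le_trans _ _ (\sum_(j : {ffun 'I_n.+1 -> 'I_m.+1})
     \int[mu]_x (`|(F \_ (eball (y j) r)) x| `^ p)%:E)%E).
    rewrite -(ge0_integral_sum mu measurableT
      (fun j => measurable_norm_powR p (mFy j)) (fun _ _ _ => powR_ge0 _ _)).
    apply: (ge0_le_integral _ measurableT).
    + by move=> x _; rewrite lee_fin powR_ge0.
    + apply: measurable_norm_powR.
      exact: restrict_measurable (box_measurable _ _) (measurable_funTS mF).
    + apply: emeasurable_sum => j; exact: measurable_norm_powR.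
    move=> x _; rewrite sumEFin lee_fin patchE.
    have rhs0 : 0 <= \sum_(j : {ffun 'I_n.+1 -> 'I_m.+1}) `|(F \_ (eball (y j) r)) x| `^ p.
      by apply: sumr_ge0 => j _; exact: powR_ge0.
    have z0 : `|0 : R| `^ p <= \sum_(j : {ffun 'I_n.+1 -> 'I_m.+1}) `|(F \_ (eball (y j) r)) x| `^ p.
      by rewrite normr0 powR0 ?gt_eqF.
    case: ifPn => // xk; rewrite {1}/F patchE; case: ifPn => // xO.
    rewrite !inE in xk xO; have [|j yx] := cov _ xO.
      move=> i; move/boxE : xk => /(_ i) /andP[]; rewrite mxE => *.
      by apply/andP; split; lra.
    rewrite (bigD1 j)//= [in leRHS]patchE mem_set// /F patchE mem_set//.
    by rewrite lerDl; apply: sumr_ge0 => i _; exact: powR_ge0.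
  apply: (@le_trans _ _ (\sum_(j : {ffun 'I_n.+1 -> 'I_m.+1}) (e `^ p * r ^+ n.+1)%:E)%E).
    by apply: lee_sum => j _; exact: yint.
  rewrite sumEFin lee_fin sumr_const card_ffun !card_ord.
  rewrite [leLHS](_ : _ = (m.+1%:R * r) ^+ n.+1 * e `^ p)//.
  by rewrite -[LHS]mulr_natr natrX exprMn [LHS]mulrC [LHS]mulrCA [LHS]mulrC.
rewrite poweR_EFin lee_fin powRM ?powR_ge0//; last first.
  by rewrite exprn_ge0// mulr_ge0// ltW.
rewrite -powRrM divff ?gt_eqF// powRr1 ?(ltW e_gt0)// ler_pM2r//.
apply: ge0_ler_powR => //; rewrite ?invr_ge0 ?(ltW p0)// nnegrE exprn_ge0// ?mulr_ge0 ?addr_ge0 ?(ltW r0)//.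
Qed.

End degenerate_weight.

(** * Inclusions between the spaces of smooth, continuous and bounded functions *)

Section function_space_inclusions.
Variables (R : realType) (n : nat) (Omega : set 'rV[R]_n.+1).
Hypothesis Omega_open : open Omega.
Local Notation T := 'rV[R]_n.+1.
Local Notation S := (Rspace R n).
Local Notation mu := (@lebesgue_rV R n).
Implicit Types (f g h u : T -> R) (a b x : T) (A B : set T).

Let mOmega : measurable (Omega : set S). Proof. exact: open_measurable_rV. Qed.

Lemma sub_ae_class (X : set (T -> R)) : X `<=` ae_class Omega X.
Proof. by move=> g Xg; exists g => //; exact: ae_eq_refl. Qed.

Lemma flat_alg_Cinfty_tilde g : flat_alg g -> Cinfty_tilde Omega g.
Proof.
move=> ng; apply: sub_ae_class; exists setT, g; split => //; first exact: openT.
exact: flat_alg_smooth.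
Qed.

Lemma Cinfty_tilde_sub : Cinfty_tilde Omega `<=` Cinfty Omega.
Proof.
(* The representative F is smooth on the open set W around the closure, so its partial derivatives
   are their own continuous extensions. *)
move=> f [f0 [W [F [oW clW sF f0F]]] ff0]; exists F.
  have OW : Omega `<=` W by apply: subset_trans clW; exact: subset_closure.
  split=> [s|s].
    by have [cF dF] := sF s; split=> [x /OW /cF|x i /OW /(dF _ i)].
  exists (partials s F) => //; apply/subspace_continuousP => x /clW Wx.
  by apply: cvg_within_filter; have [+ _] := sF s; apply.
apply: ae_eq_trans ff0 _; apply: aeW => x Ox /=.
by apply: f0F; exact: subset_closure.
Qed.

Lemma flat_alg_C0ub g : flat_alg g -> C0ub Omega g.
Proof.
move=> ng; apply: sub_ae_class; split.
  have [C C0 gC] := flat_alg_bounded ng.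
  exists C; split; first exact: num_real.
  by move=> M CM x _; apply: le_trans (gC x) (ltW CM).
move=> e e0; have [L L0 gL] := flat_alg_lipschitz ng.
have L10 : 0 < L + 1 by rewrite ltr_wpDl.
exists (e / (L + 1)); first by rewrite divr_gt0.
move=> x y _ _ xy; apply: (@le_lt_trans _ _ (L * enorm (x - y))).
  by apply: gL => i; have := coord_le_enorm (x - y) i; rewrite !mxE.
apply: (@le_lt_trans _ _ ((L + 1) * enorm (x - y))).
  by rewrite ler_wpM2r ?enorm_ge0// lerDl.
by rewrite mulrC -ltr_pdivlMr.
Qed.

(** Rests on the completeness of the Caratheodory measure: every subset of a null set is
    measurable. *)
Lemma ae_eq_lebesgue_measurable f g : lebesgue_measurable_fun Omega g ->
  (f : S -> R) = g %[ae mu in (Omega : set S)] -> lebesgue_measurable_fun Omega f.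
Proof.
move=> mg fg; apply/measurable_EFinP.
apply: (@ae_measurable_fun _ S R mu _ Omega (EFin \o g)).
- exact: measure_is_complete_caratheodory.
- by apply: ae_eq_sym; exact: (ae_eq_comp EFin fg).
- exact/measurable_EFinP.
Qed.

Lemma C0ub_sub_Linfty : C0ub Omega `<=` Linfty Omega.
Proof.
move=> f [g [[M [_ gM]] gu] fg].
have {gM} gM x : closure Omega x -> `|g x| <= M + 1.
  by move=> cx; apply: (gM (M + 1)) cx; rewrite ltrDl.
have mg : lebesgue_measurable_fun Omega g.
  apply: nbhs_measurable_fun => // x; rewrite inE => Ox.
  apply/(@cvgrPdist_lt _ _ _ _ (nbhs_filter x)) => e e0.
  have [d d0 gd] := gu _ e0.
  (* A max-norm ball of this radius has Euclidean radius at most d/2. *)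
  have d'0 : 0 < d / (2 * n.+1%:R) by rewrite divr_gt0// mulr_gt0.
  near=> y.
  have [_ xy] : ball x (d / (2 * n.+1%:R)) y by near: y; exact: nbhsx_ballx.
  have Oy : Omega y by near: y; exact: open_nbhs_nbhs.
  apply: gd; [exact: subset_closure..|].
  apply: (@le_lt_trans _ _ (n.+1%:R * (d / (2 * n.+1%:R)))).
    by apply: enorm_le => [|i]; [exact: ltW|rewrite !mxE; exact/ltW/(xy 0 i)].
  rewrite (_ : n.+1%:R * _ = d / 2); first by rewrite ltr_pdivrMr// ltr_pMr// ltr1n.
  have n0 : 0 < n.+1%:R :> R by [].
  by field; rewrite gt_eqF.
split; first exact: ae_eq_lebesgue_measurable mg fg.
rewrite /Lp_norm unlock /Lnorm; case: ifPn => // _.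
apply: (@le_lt_trans _ _ (Num.max 0 (M + 1))%:E); last exact: ltry.
apply/ess_supP; move: fg; apply: filterS => x /= fgx.
rewrite patchE; case: ifPn => [xO|_]; last by rewrite normr0 lee_fin le_max lexx.
rewrite inE in xO; rewrite fgx// lee_fin le_max gM ?orbT//.
exact: subset_closure.
Unshelve. all: by end_near. Qed.

Lemma coord_le_mx_norm x i : `|x 0 i| <= `|x|.
Proof.
rewrite /Num.norm/= mx_normrE.
exact: (le_bigmax _ (fun ij : 'I_1 * 'I_n.+1 => `|x ij.1 ij.2|) (0, i)).
Qed.

Lemma bounded_lebesgue_lty : bounded_set Omega -> (mu Omega < +oo)%E.
Proof.
move=> [M [_ OM]].
have {OM} OM x : Omega x -> `|x| <= M + 1 by apply: OM; rewrite ltrDl.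
have OB : Omega `<=` box (0 - const_mx (M + 2)) (0 + const_mx (M + 2)).
  move=> x /OM xM; apply/boxE => i; rewrite mxE.
  have := le_trans (coord_le_mx_norm x i) xM; rewrite ler_norml => /andP[? ?].
  by apply/andP; split; lra.
apply: (le_lt_trans (le_lebesgue_outer OB)).
exact: le_lt_trans (lebesgue_rV_box_le _ _) (ltry _).
Qed.

Lemma bounded_closure_compact : bounded_set Omega -> compact (closure Omega).
Proof.
move=> [M [_ OM]]; apply: bounded_closed_compact; last exact: closed_closure.
have clM : closed [set x : T | `|x| <= M + 1].
  have /continuous_closedP : continuous (fun x : T => `|x|) by exact: norm_continuous.
  by move=> /(_ _ (@closed_le R (M + 1))).
have cOM : closure Omega `<=` [set x : T | `|x| <= M + 1].
  rewrite [X in _ `<=` X](closure_id _).1//; apply: closureS => x.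
  by apply: OM; rewrite ltrDl.
exists (M + 1); split; first exact: num_real.
by move=> K MK x /cOM /= xM; apply: le_trans xM (ltW MK).
Qed.

(** The Heine-Cantor theorem with a Euclidean modulus. Compactness is used as a near-covering
    property whose parameter is the modulus d tending to 0 from the right. *)
Lemma within_continuous_unif (K : set T) g : compact K ->
  {within K, continuous g} -> forall e : R, 0 < e -> exists2 d : R, 0 < d &
  forall x y, K x -> K y -> enorm (x - y) < d -> `|g x - g y| < e.
Proof.
move=> cK /subspace_continuousP cg e e0.
have e20 : 0 < e / 2 by rewrite divr_gt0.
pose P (d : R) x := K x -> forall y, K y -> enorm (x - y) < d -> `|g x - g y| < e.
have /(_ R (0^'+) P _) : near_covering K by exact/compact_near_coveringP.
case=> [x Kx|d /= d0 dP]; last first.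
  exists (d / 2) => [|x y Kx Ky xy]; first by rewrite divr_gt0.
  apply: (dP (d / 2)) => //=.
  - by rewrite sub0r normrN gtr0_norm ?divr_gt0// ltr_pdivrMr// ltr_pMr// ltr1n.
  - by rewrite divr_gt0.
have /cvgrPdist_lt /(_ _ e20) := cg _ Kx.
rewrite near_withinE => /nbhs_ballP[c /= c0 xc].
have c20 : 0 < c / 2 by rewrite divr_gt0.
near=> z d => Kz y Ky zy.
have [_ xz] : ball x (c / 2) z by near: z; exact: nbhsx_ballx.
have dc : d < c / 2 by near: d; exact: nbhs_right_lt.
have gz : `|g x - g z| < e / 2.
  apply: xc => //; split => // i j; apply: le_ball (xz i j).
  by rewrite ler_pdivrMr// ler_pMr// ler1n.
have gy : `|g x - g y| < e / 2.
  apply: xc => //; split => // i j; rewrite (ord1 i) (splitr c).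
  apply: ball_triangle (xz 0 j) _; rewrite /ball/=.
  apply: le_lt_trans (lt_trans zy dc).
  by have := coord_le_enorm (z - y) j; rewrite !mxE.
rewrite (_ : g z - g y = (g x - g y) - (g x - g z)); last by ring.
by rewrite (le_lt_trans (ler_normB _ _))// (splitr e) ltrD.
Unshelve. all: by end_near. Qed.

Lemma Cinfty_sub_C0ub : bounded_set Omega -> Cinfty Omega `<=` C0ub Omega.
Proof.
(* Only the empty multi-index is used: g extends the function itself to the closure. *)
move=> bO f [f0 [_ /(_ [::])[g cg gf0]] ff0].
have cO := bounded_closure_compact bO.
exists g.
  split; last exact: within_continuous_unif.
  have [M [_ gM]] := compact_bounded (continuous_compact cg cO).
  exists M; split; first exact: num_real.
  by move=> K MK x Ox; apply: (gM K MK); exists x.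
apply: ae_eq_trans ff0 _; apply: aeW => x Ox /=.
by rewrite gf0.
Qed.

End function_space_inclusions.

(** * Consequences of the conditions on the weight *)

Section weights.
Variables (R : realType) (n : nat) (p : R) (w : R -> R).

Lemma ereal_inf_pos_lower_bound :
  (0 < ereal_inf [set (w r)%:E | r in [set r : R | 0 < r]%R])%E ->
  exists2 c : R, 0 < c & forall r, 0 < r -> c <= w r.
Proof.
set i := ereal_inf _ => i0.
have ile r : 0 < r -> (i <= (w r)%:E)%E.
  by move=> r0; apply: ereal_inf_lbound; exists r.
have ifin : i \is a fin_num.
  by rewrite ge0_fin_numE ?(ltW i0)//; exact: le_lt_trans (ile _ ltr01) (ltry _).
exists (fine i); first by rewrite fine_gt0// i0 -ge0_fin_numE// ltW.
by move=> r /ile; rewrite -lee_fin fineK.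
Qed.

Lemma ereal_sup_lty_upper_bound (D : set R) (f : R -> R) :
  (ereal_sup [set (f r)%:E | r in D] < +oo)%E ->
  exists2 M : R, 0 < M & forall r, D r -> f r <= M.
Proof.
have [->|/set0P[x0 Dx0]] := eqVneq D set0; first by exists 1.
set s := ereal_sup _ => soo.
have ub x : D x -> ((f x)%:E <= s)%E.
  by move=> Dx; apply: ereal_sup_ubound; exists x.
have sfin : s \is a fin_num.
  by rewrite fin_real// soo andbT (lt_le_trans _ (ub _ Dx0))// ltNyr.
exists (Num.max 1 (fine s)); first by rewrite lt_max ltr01.
move=> x /ub fs; rewrite le_max; apply/orP; right.
by rewrite -lee_fin fineK.
Qed.

Hypothesis weight : morrey_weight n p w.
Hypothesis p0 : 0 < p.

(** For r between rho and 1, the bound M on w r * r^(n/p) gives w r <= M / rho^(n/p); from 1 on, w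
    is bounded by assumption. So the weight condition of (ii) and (iii) implies that of (i). *)
Lemma morrey_weight_bounded rho : 0 < rho ->
  exists2 W : R, 0 < W & forall r, rho <= r -> w r <= W.
Proof.
move=> rho0; have [/ereal_sup_lty_upper_bound[M M0 wM]] := weight.
move=> /ereal_sup_lty_upper_bound[M' M'0 wM'] _.
have rp0 : 0 < rho `^ (n.+1%:R / p) by exact: powR_gt0.
exists (M / rho `^ (n.+1%:R / p) + M'); first by rewrite addr_gt0// divr_gt0.
move=> r rhor; have [r1|r1] := leP 1 r.
  by rewrite (le_trans (wM' _ r1))// lerDr ltW// divr_gt0.
apply: (@le_trans _ _ (M / rho `^ (n.+1%:R / p))); last by rewrite lerDl ltW.
have r0 : 0 < r by exact: lt_le_trans rhor.
have := wM r; rewrite /= r0 (ltW r1) => /(_ isT) wrM.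
have [wr0|wr0] := leP (w r) 0; first by rewrite (le_trans wr0)// ltW// divr_gt0.
rewrite ler_pdivlMr//; apply: le_trans wrM; rewrite ler_pM2l//.
by apply: ge0_ler_powR; rewrite ?nnegrE ?divr_ge0// ltW.
Qed.

Lemma morrey_weight_vanishes : scaled_weight_vanishes n p w.
Proof.
have [_ _ cvg0] := weight => e e0.
have e0' : (0 < e%:E)%E by [].
have [d /= d0 de] := cvg0 _ (open_ereal_lt' e0').
exists (d / 2) => [|r /andP[r0 rd]]; first by rewrite divr_gt0.
have d20 : 0 < d / 2 by rewrite divr_gt0.
have := de (d / 2); rewrite /= sub0r normrN gtr0_norm//.
rewrite ltr_pdivrMr// ltr_pMr// ltr1n => /(_ isT d20) /ltW.
rewrite -lee_fin; apply: le_trans; apply: ereal_sup_ubound.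
by exists r => //=; rewrite r0 ltW.
Qed.

End weights.

(** * Bounded functions in the vanishing space, and the closures *)

Section morrey_spaces.
Variables (R : realType) (n : nat) (Omega : set 'rV[R]_n.+1) (p : R) (w : R -> R).
Hypothesis Omega_open : open Omega.
Hypothesis p1 : 1 <= p.
Hypothesis w_gt0 : forall r, 0 < r -> 0 < w r.
Hypothesis w_ge : exists2 c : R, 0 < c & forall r, 0 < r -> c <= w r.
Hypothesis w_le : forall rho, 0 < rho -> exists2 W : R, 0 < W &
  forall r, rho <= r -> w r <= W.
Local Notation T := 'rV[R]_n.+1.
Local Notation S := (Rspace R n).
Local Notation mu := (@lebesgue_rV R n).
Implicit Types (f g h u : T -> R) (a b x : T) (A B : set T).

Let p0 : 0 < p. Proof. exact: lt_le_trans p1. Qed.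
Let mOmega : measurable (Omega : set S). Proof. exact: open_measurable_rV. Qed.

Lemma Lp_norm_ae_eq A f g : measurable (A : set S) -> A `<=` Omega ->
  lebesgue_measurable_fun Omega f -> lebesgue_measurable_fun Omega g ->
  (f : S -> R) = g %[ae mu in (Omega : set S)] ->
  Lp_norm A p%:E f = Lp_norm A p%:E g.
Proof.
move=> mA AO mf mg fg.
have mr u : lebesgue_measurable_fun Omega u ->
    measurable_fun setT (fun x : S => (`|(u \_ A) x| `^ p)%:E).
  move=> mu_; apply: measurable_norm_powR; apply: restrict_measurable => //.
  exact: measurable_subset mu_.
rewrite !Lp_normE !LnormE; congr (_ `^ _)%E.
apply: (ae_eq_integral _ _ measurableT (mr _ mf) (mr _ mg)).
move: fg; apply: filterS => x /= fgx _; rewrite !patchE; case: ifPn => // xA.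
by rewrite fgx//; apply: AO; rewrite inE in xA.
Qed.

Lemma morrey0_ae_eq f g : lebesgue_measurable_fun Omega f ->
  (f : S -> R) = g %[ae mu in (Omega : set S)] ->
  morrey0 w p%:E Omega g -> morrey0 w p%:E Omega f.
Proof.
move=> mf fg /morrey0P[[mg gM] vg].
have eqB x r : Lp_norm (eball x r `&` Omega) p%:E f =
    Lp_norm (eball x r `&` Omega) p%:E g.
  by apply: Lp_norm_ae_eq => //; exact: eballI_measurable.
apply/morrey0P; split; first split => //.
  apply: le_lt_trans gM; apply: morrey_sup_le => [|x r Ox r0 _].
    exact: morrey_sup_ge0.
  by rewrite eqB; apply: le_morrey_sup => //; exact: ltry.
by move=> e /vg[d d0 gd]; exists d => // x r Ox rd; rewrite eqB; exact: gd.
Qed.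

Lemma Linfty_ae_bounded f : Linfty Omega f ->
  exists M : R, \forall x \ae mu, `|(f \_ Omega : S -> R) x| <= M.
Proof.
move=> [_]; rewrite /Lp_norm unlock /Lnorm; case: ifPn => [mu0|].
  set s := ess_sup _ _ => soo; have s0 : (0 <= s)%E.
    by apply: ess_sup_gee => //; apply: nearW => x; exact: abse_ge0.
  exists (fine s); have := ess_sup_ge mu (abse \o (EFin \o (f \_ Omega : S -> R))).
  apply: filterS => x /= xs; rewrite -lee_fin fineK// ge0_fin_numE//.
(* The L^oo norm is set to 0 when the whole space is null; then any bound holds almost
   everywhere. *)
rewrite -leNgt => mu0 _; exists 0; exists setT; split => //.
by apply/eqP; rewrite eq_le mu0 measure_ge0.
Qed.

(** Truncating f to 0 where |f| exceeds its essential bound gives a representative that is bounded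
    everywhere. It is in L^p because Omega has finite measure, and the result passes back to f by
    almost everywhere equality. *)
Lemma Linfty_sub_morrey0 : scaled_weight_vanishes n p w ->
  (mu Omega < +oo)%E -> Linfty Omega `<=` morrey0 w p%:E Omega.
Proof.
move=> w0 Ofin f /[dup] [[mf _]] /Linfty_ae_bounded[M fM].
pose F : S -> R := f \_ Omega.
have mF : measurable_fun setT F by exact: restrict_measurable.
pose A : set S := [set x | `|F x| <= M].
have mA : measurable A.
  have mnF : measurable_fun setT (fun x : S => `|F x|) by exact: measurableT_comp.
  rewrite (_ : A = setT `&` (fun x : S => `|F x|) @^-1` `]-oo, M]%classic).
    exact: mnF.
  by rewrite setTI; apply/seteqP; split => x /=; rewrite in_itv.
pose g : T -> R := F \_ A.
have gM x : `|g x| <= Num.max 0 M.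
  rewrite /g patchE; case: ifPn => [|_]; last by rewrite normr0 le_max lexx.
  by rewrite inE le_max => ->; rewrite orbT.
have mg : lebesgue_measurable_fun Omega g.
  by apply: measurable_funTS; apply: restrict_measurable => //; exact: measurable_funTS.
apply: (@morrey0_ae_eq f g) => //.
  move: fM; apply: filterS => x /= xM Ox.
  by rewrite /g patchE mem_set// /F patchE mem_set.
apply: vanishing_Lp_morrey0 => //.
  apply: le_lt_trans (Lp_norm_bounded p1 mOmega mg _ (fun x _ => gM x)) _.
    by rewrite le_max lexx.
  by rewrite lte_mul_pinfty// ?lee_fin ?le_max ?lexx//; exact: poweR_lty.
move=> e e0; have [d d0 small] := bounded_small_radii Omega_open p1 w_gt0 (Num.max 0 M) w0 e0.
by exists d => //; apply: small.
Qed.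

Lemma morrey0_flat_alg_density f e : morrey0 w p%:E Omega f -> 0 < e ->
  exists g, [/\ flat_alg g, morrey0 w p%:E Omega g &
    (morrey_norm w p%:E Omega (f \- g)%R < e%:E)%E].
Proof.
move=> fM e0; have [w0|nw0] := pselect (scaled_weight_vanishes n p w).
  exact: flat_alg_morrey_density.
have f0 := degenerate_Lp_norm0 Omega_open p1 w_gt0 nw0 fM.
have mf : lebesgue_measurable_fun Omega f := fM.1.1.
have mz A : lebesgue_measurable_fun A (fun=> 0 : R) by exact: measurable_cst.
have z0 A : measurable (A : set S) -> (Lp_norm A p%:E (fun=> 0%R) <= 0)%E.
  move=> mA; apply: le_trans (Lp_norm_bounded p1 mA (mz A) (lexx 0) _) _.
    by move=> x _; rewrite normr0.
  by rewrite mul0e.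
(* In the degenerate case f has zero L^p norm on Omega, so the zero function approximates it
   exactly. *)
exists (fun=> 0); split; first exact: flat_alg_cst.
  apply: vanishing_Lp_morrey0 => //; first exact: le_lt_trans (z0 _ mOmega) (ltry _).
  move=> c c0; exists 1 => // x r _ /andP[r0 _].
  have wr0 := w_gt0 r0.
  apply: (@le_trans _ _ ((w r)%:E * 0)%E); last by rewrite mule0 lee_fin ltW.
  apply: lee_wpmul2l; first by rewrite lee_fin ltW.
  by apply: z0; exact: eballI_measurable.
have -> : (f \- (fun=> 0))%R = f by apply/funext => x /=; rewrite subr0.
apply: (@le_lt_trans _ _ 0%E); last by rewrite lte_fin.
apply: morrey_sup_le => // x r Ox r0 _; have wr0 := w_gt0 r0.
rewrite -(mule0 (w r)%:E); apply: lee_wpmul2l; first by rewrite lee_fin ltW.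
rewrite -f0; apply: Lp_norm_le_set => //; exact: eballI_measurable.
Qed.

(** The common core of the three parts. The vanishing space is included in the closure of X, that in
    the closure of Y, and that in the vanishing space again. *)
Lemma morrey_closureE (X Y : set (T -> R)) : X `<=` Y ->
  Y `<=` morrey0 w p%:E Omega ->
  (forall g, flat_alg g -> morrey0 w p%:E Omega g -> X g) ->
  morrey_closure w p%:E Omega X = morrey_closure w p%:E Omega Y /\
  morrey_closure w p%:E Omega Y = morrey0 w p%:E Omega.
Proof.
move=> XY YM flatX.
have cXY : morrey_closure w p%:E Omega X `<=` morrey_closure w p%:E Omega Y.
  by move=> f [fM fX]; split => // e /fX[g /XY Yg fg]; exists g.
have cYM : morrey_closure w p%:E Omega Y `<=` morrey0 w p%:E Omega.
  exact: morrey_closure_sub.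
have cMX : morrey0 w p%:E Omega `<=` morrey_closure w p%:E Omega X.
  move=> f fM; split => [|e e0]; first exact: fM.1.
  have [g [ng gM fg]] := morrey0_flat_alg_density fM e0.
  by exists g => //; exact: flatX.
split; apply/seteqP; split => //.
- by apply: subset_trans cYM cMX.
- by apply: subset_trans cMX cXY.
Qed.

End morrey_spaces.

Theorem theorem14p13 (R : realType) (n : nat) (Omega : set 'rV[R]_n.+1)
    (p : R) (w : R -> R)
    (Omega_open : open Omega)
    (p_ge1 : 1 <= p)
    (w_gt0 : forall r : R, 0 < r -> 0 < w r)
    (w_inf : (0 < ereal_inf [set (w r)%:E | r in [set r : R | 0 < r]%R])%E)
    (w_doubling : (ereal_sup [set (w r / w (2 * r))%:E
                             | r in [set r : R | 0 < r]%R] < +oo)%E) :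
  [/\ (forall rho : R, 0 < rho ->
         (ereal_sup [set (w r)%:E | r in [set r : R | rho <= r]%R] < +oo)%E) ->
      morrey_closure w p%:E Omega
        (morrey0 w p%:E Omega `&` Cinfty_tilde Omega `&` C0ub Omega)
      = morrey_closure w p%:E Omega
        (morrey0 w p%:E Omega `&` Cinfty Omega `&` C0ub Omega) /\
      morrey_closure w p%:E Omega
        (morrey0 w p%:E Omega `&` Cinfty Omega `&` C0ub Omega)
      = morrey0 w p%:E Omega,
      (lebesgue_rV Omega < +oo)%E -> morrey_weight n p w ->
      [/\ C0ub Omega `<=` Linfty Omega,
          Linfty Omega `<=` morrey0 w p%:E Omega,
          morrey_closure w p%:E Omega (Cinfty_tilde Omega `&` C0ub Omega)
          = morrey_closure w p%:E Omega (Cinfty Omega `&` C0ub Omega) &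
          morrey_closure w p%:E Omega (Cinfty Omega `&` C0ub Omega)
          = morrey0 w p%:E Omega] &
      bounded_set Omega -> morrey_weight n p w ->
      [/\ Cinfty_tilde Omega `<=` Cinfty Omega,
          Cinfty Omega `<=` C0ub Omega,
          C0ub Omega `<=` Linfty Omega,
          Linfty Omega `<=` morrey0 w p%:E Omega &
          morrey_closure w p%:E Omega (Cinfty_tilde Omega)
          = morrey_closure w p%:E Omega (Cinfty Omega) /\
          morrey_closure w p%:E Omega (Cinfty Omega)
          = morrey0 w p%:E Omega]].
Proof.
have w_ge := ereal_inf_pos_lower_bound w_inf.
have p0 : 0 < p by exact: lt_le_trans p_ge1.
split.
- move=> w_sup.
  have w_le rho : 0 < rho -> exists2 W : R, 0 < W & forall r, rho <= r -> w r <= W.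
    by move=> /w_sup /ereal_sup_lty_upper_bound.
  apply: morrey_closureE => //.
  + move=> f [[fM fC] fu]; split => //; split => //.
    exact: Cinfty_tilde_sub.
  + by move=> f [[]].
  + move=> g ng gM; split; last exact: flat_alg_C0ub.
    by split => //; exact: flat_alg_Cinfty_tilde.
- move=> Ofin weight.
  have w_le := morrey_weight_bounded weight p0.
  have w0 := morrey_weight_vanishes weight.
  have LM := Linfty_sub_morrey0 Omega_open p_ge1 w_gt0 w_le w0 Ofin.
  have CL := C0ub_sub_Linfty Omega_open.
  have [E1 E2] : morrey_closure w p%:E Omega (Cinfty_tilde Omega `&` C0ub Omega)
      = morrey_closure w p%:E Omega (Cinfty Omega `&` C0ub Omega) /\
      morrey_closure w p%:E Omega (Cinfty Omega `&` C0ub Omega)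
      = morrey0 w p%:E Omega.
    (* No intersection with the vanishing space is needed here, since [C0ub] is contained in it
       through [Linfty]. *)
    apply: morrey_closureE => //.
    + by move=> f [fC fu]; split => //; exact: Cinfty_tilde_sub.
    + by move=> f [_ /CL /LM].
    + by move=> g ng _; split; [exact: flat_alg_Cinfty_tilde|exact: flat_alg_C0ub].
  by split.
- move=> Obounded weight.
  have w_le := morrey_weight_bounded weight p0.
  have w0 := morrey_weight_vanishes weight.
  have Ofin := bounded_lebesgue_lty Obounded.
  have LM := Linfty_sub_morrey0 Omega_open p_ge1 w_gt0 w_le w0 Ofin.
  have CL := C0ub_sub_Linfty Omega_open.
  have CC := Cinfty_sub_C0ub Obounded.
  have TC := @Cinfty_tilde_sub R n Omega.
  split => //; apply: morrey_closureE => //.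
  + by move=> f /CC /CL /LM.
  + by move=> g ng _; exact: flat_alg_Cinfty_tilde.
Qed.
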